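(* Let $X$ be a connected compact (metrizable) abelian group and let $T:X\to X$ be a minimal affine transformation. Then $(X,T)$ has quasi-discrete spectrum of some order $d_T$ ($1\le d_T\le\infty$), and the following holds. Let $\ell\ge 1$ be an integer, let $q_1,\dots,q_\ell\in\mathbb{Q}[z]$ be polynomials with $q_j(n)\in\mathbb{N}$ for every integer $n\ge 0$ and every $1\le j\le\ell$, put $\Delta:=\max_{1\le j\le \ell}\deg q_j$, where $\Delta\ge 1$, and let $(c_n)_{n\ge 0}$ be a sequence of complex numbers that is oscillating of order $d_T\Delta$ (fully oscillating if $d_T=\infty$) and satisfies $\sum_{n=1}^{N}|c_n|=O(N)$ as $N\to\infty$. Then for every continuous function $F\in C(X^\ell)$ (complex valued) and every point $x\in X$, $$\lim_{N\to\infty}\frac1N\sum_{n=0}^{N-1}c_n\,F\bigl(T^{q_1(n)}x,\dots,T^{q_\ell(n)}x\bigr)=0 .$$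
   Context: $\mathbb{N}=\{0,1,2,\dots\}$ and $T^0$ is the identity. An affine transformation of a compact abelian group $X$ (written additively) is a map $T(x)=A(x)+b$ with $A$ a continuous group automorphism of $X$ and $b\in X$. $T$ is minimal if the orbit $\{T^nx:n\ge 0\}$ of every $x\in X$ is dense in $X$. Oscillating sequences. For an integer $d\ge 1$, a sequence of complex numbers $(c_n)_{n\ge 0}$ is oscillating of order $d$ if for every real polynomial $P\in\mathbb{R}[z]$ of degree at most $d$ one has $\lim_{N\to\infty}\frac1N\sum_{n=0}^{N-1}c_n e^{2\pi i P(n)}=0$. It is fully oscillating (oscillating of order $\infty$) if it is oscillating of order $d$ for all $d\ge 1$. Dynamical systems. A dynamical system is a pair $(X,T)$ where $X$ is a compact metric space and $T:X\to X$ is a continuous map. It is transitive if there is some $x\in X$ whose orbit $\{T^nx:n\ge 0\}$ is dense in $X$. $C(X)$ is the Banach algebra of continuous complex valued functions on $X$ with the sup norm. Quasi-discrete spectrum. Let $(X,T)$ be a transitive dynamical system and let $G(X)=\{f\in C(X): |f(x)|=1 \text{ for all } x\in X\}$, a group under pointwise multiplication. Let $G_1$ be the set of all $f\in G(X)$ for which there is $\lambda\in\mathbb{C}$ with $f\circ T=\lambda f$. Inductively, for $n\ge 1$, let $G_{n+1}$ be the set of all $f\in G(X)$ for which there is $g\in G_n$ with $f\circ T=g f$. Then $G_1\subset G_2\subset\cdots$. The elements of $G:=\bigcup_{n\ge 1}G_n$ are called quasi-eigenfunctions. The system $(X,T)$ has quasi-discrete spectrum if the algebra generated by the quasi-eigenfunctions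 is dense in $C(X)$. If $(X,T)$ has quasi-discrete spectrum, its order $d_T$ is the least integer $d\ge 1$ such that $G_d=G_{d+1}$, and $d_T=\infty$ if there is no such integer. *)

(* Defs.v *)
(* MathComp + MathComp-Analysis; complex numbers are R[i] from real-closed. *)
From HB Require Import structures.
From mathcomp Require Import all_boot all_order all_algebra.
From mathcomp Require Import all_classical all_reals all_analysis.
From mathcomp Require Import complex.
Set Implicit Arguments.
Unset Strict Implicit.
Unset Printing Implicit Defensive.
Import Order.TTheory GRing.Theory Num.Theory.
Import numFieldTopology.Exports numFieldNormedType.Exports.

Local Open Scope classical_set_scope.
Local Open Scope ring_scope.

(* [R[i]] itself carries no topology in the library; the regular algebra
   [(R[i])^o], which is convertible to it, has the one given by the modulus. *)
Notation cplx R := ((R[i])^o).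

Section Oscillation.
Variable R : realType.

(* e^{2 pi i t} *)
Definition expi2pi (t : R) : cplx R :=
  (cos (2 * pi * t) +i* sin (2 * pi * t))%C.

Definition average (u : nat -> cplx R) (N : nat) : cplx R :=
  (N%:R)^-1 * \sum_(n < N) u n.

Definition oscillating_of_order (d : nat) (c : nat -> cplx R) : Prop :=
  forall P : {poly R}, (size P <= d.+1)%N ->
    average (fun n => c n * expi2pi P.[n%:R]) N @[N --> \oo] --> (0 : cplx R).

Definition fully_oscillating (c : nat -> cplx R) : Prop :=
  forall d : nat, (1 <= d)%N -> oscillating_of_order d c.

(* Orders range over {1, 2, ..., oo}; [None] encodes the order oo. *)
Definition oscillating (d : option nat) (c : nat -> cplx R) : Prop :=
  if d is Some d then oscillating_of_order d c else fully_oscillating c.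

End Oscillation.

Definition mul_order (d : option nat) (k : nat) : option nat :=
  omap (fun d => d * k)%N d.

Section Dynamics.
Variables (X : topologicalType) (T : X -> X).

Definition orbit_set (x : X) : set X := range (fun n : nat => iter n T x).

Definition transitive_map : Prop := exists x : X, dense (orbit_set x).

Definition minimal_map : Prop := forall x : X, dense (orbit_set x).

End Dynamics.

(* The topology of X is induced by some (R-valued) distance. *)
Definition metrizable (R : realType) (X : topologicalType) : Prop :=
  exists dist : X -> X -> R,
    [/\ forall x y, 0 <= dist x y,
        forall x y, dist x y = 0 <-> x = y,
        forall x y, dist x y = dist y x,
        forall x y z, dist x z <= dist x y + dist y z
      & forall (x : X) (U : set X),
          nbhs x U <-> exists2 e : R, 0 < e & [set y | dist x y < e] `<=` U].

Section QuasiDiscreteSpectrum.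
Variables (R : realType) (X : topologicalType) (T : X -> X).

Definition unimodular : set (X -> cplx R) :=
  [set f | continuous f /\ forall x, `|f x| = 1].

(* The groups G_1, G_2, ...; the value at 0 is junk and never used. *)
Fixpoint quasi_eigen (n : nat) : set (X -> cplx R) :=
  match n with
  | 0 => set0
  | 1 => [set f | unimodular f /\
                  exists lam : cplx R, forall x, f (T x) = lam * f x]
  | n'.+1 => [set f | unimodular f /\
                  exists2 g, quasi_eigen n' g & forall x, f (T x) = g x * f x]
  end.

Definition quasi_eigenfunctions : set (X -> cplx R) :=
  \bigcup_(n in [set n | (1 <= n)%N]) quasi_eigen n.

Definition is_subalgebra (A : set (X -> cplx R)) : Prop :=
  [/\ forall f g, A f -> A g -> A (fun x => f x + g x),
      forall f g, A f -> A g -> A (fun x => f x * g x)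
    & forall (a : cplx R) f, A f -> A (fun x => a * f x)].

Definition generated_algebra (S : set (X -> cplx R)) : set (X -> cplx R) :=
  smallest is_subalgebra S.

Definition sup_dense (A : set (X -> cplx R)) : Prop :=
  forall f : X -> cplx R, continuous f -> forall e : R, 0 < e ->
    exists2 g, A g & forall x, `|f x - g x| < (e%:C)%C :> R[i].

Definition has_quasi_discrete_spectrum : Prop :=
  [/\ continuous T, transitive_map T
    & sup_dense (generated_algebra quasi_eigenfunctions)].

Definition stationary_at (d : nat) : Prop :=
  (1 <= d)%N /\ quasi_eigen d = quasi_eigen d.+1.

Lemma ex_stationary_bool :
  (exists d, stationary_at d) -> exists d, `[< stationary_at d >].
Proof. by move=> [d dP]; exists d; apply/asboolP. Qed.

(* The order d_T: the least d >= 1 with G_d = G_{d+1}; [None] (i.e. oo) if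
   there is none. *)
Definition qds_order : option nat :=
  if pselect (exists d, stationary_at d) is left h
  then Some (ex_minn (ex_stationary_bool h)) else None.

End QuasiDiscreteSpectrum.

(* On a compact Hausdorff group, A^-1 is automatically continuous. *)
Definition affine_transformation (X : topologicalZmodType) (T : X -> X) : Prop :=
  exists (A : {additive X -> X}) (b : X),
    [/\ bijective A, continuous A & forall x, T x = A x + b].

(* Main.v *)
From HB Require Import structures.
Require Import Defs.
From mathcomp Require Import all_boot all_order all_algebra.
From mathcomp Require Import all_classical all_reals all_analysis.
From mathcomp Require Import complex ring lra zify.
Import Order.TTheory GRing.Theory Num.Theory.
Import numFieldTopology.Exports numFieldNormedType.Exports.
Import ComplexField.Normc.
Set Implicit Arguments.
Unset Strict Implicit.
Unset Printing Implicit Defensive.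
Local Open Scope classical_set_scope.
Local Open Scope ring_scope.

(** Write [T x = A x + b] and [B x = A x - x], and let [e] be [expi2pi].

The continuous characters of [X] are shown to be quasi-eigenfunctions, and
their linear span is dense in [C(X)] by Stone-Weierstrass; this is the quasi-discrete spectrum.  The products of characters of the separate coordinates
span a dense subspace of [C(X^l)] for the same reason, so by the bound on the
means of [|c_n|] it is enough to treat such a product ([vanishes_approx]).  A
quasi-eigenfunction [f] in [G_d] satisfies [f (T^m x) = e (P m)] with [P] a real
polynomial of degree at most [d] ([quasi_eigen_phase]): the phase of [f] is a
discrete antiderivative of the phase of its multiplier.  Since all the [G_n]
lie in [G_d] when [d] is the order, a product of characters taken at the points
[T^(q_j n) x] is [e (Q n)] with [deg Q] at most [d * Delta], and oscillation
applies ([tensor_vanishes]).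

Two facts about [X] carry the rest.

Characters separate points ([char_separation]).  The Haar mean of a continuous
function is the number which averages of finitely many translates approximate
uniformly; such numbers exist because averaging over translates of a small
neighbourhood of [0] that cover [X] contracts the oscillation by a fixed
factor.  It makes [C(X)] a commutative convolution algebra.  If [w] is a nonzero
self-adjoint element, its even powers, normalised to be [1] at [0], converge
uniformly to a multiple of an idempotent that is an eigenvector of [w * w]
([power_idempotent]): the spectral projection of the top eigenvalue, obtained
without spectral theory from the log-convexity and the submultiplicativity of
the values at [0].  The value at [0] of an idempotent, its rank, is at least [1]
and is additive, so that below every idempotent there is a minimal one, and a
minimal idempotent is a multiple of a character because its ideal is a line.
Applied to [w = g * g~] with [g] the difference of a function and its translate
by [x0], this gives a character that is not [1] at [x0].

Every character is killed by a power of [B] ([char_unipotent]).  Let a group of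
characters be stable under composition with [A], and such that its [A]-invariant
members are [1] at [b].  Then [T] has a fixed point modulo the common
kernel of each orbit of the group ([fixed_point]), hence a closed invariant
coset of it, and minimality forces the group to be trivial.  The characters
[chi o f(A)], for [f] an integer polynomial, form such a group unless some
nonzero [f] satisfies [chi o f(A) = 1].  In that case write
[f = (X - 1)^k g] with [g(1) <> 0]; for [chi' = chi o B^k] an invariant member
[eta] of its group satisfies [eta ^ g(1) = 1], so that [eta = 1] by
connectedness, and the group of [chi'] is trivial. *)

(** * The real modulus of a complex number and continuity *)

Section NormC.
Variable R : realType.
Implicit Types z w : cplx R.

Lemma normcE z : `|z| = (normc z)%:C%C. Proof. by []. Qed.

Lemma normc_ge0 z : 0 <= normc z. Proof. by case: z => a b /=; exact: sqrtr_ge0. Qed.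

Lemma normcD z w : normc (z + w) <= normc z + normc w.
Proof. by have := ler_normD (z : R[i]) w; rewrite !normcE -rmorphD lecR. Qed.

Lemma normcN z : normc (- z) = normc z.
Proof. by case: z => a b /=; rewrite !sqrrN. Qed.

Lemma normc_distC z w : normc (z - w) = normc (w - z).
Proof. by rewrite -normcN opprB. Qed.

Lemma normc_eq0P z : normc z = 0 <-> z = 0.
Proof. by split=> [/eq0_normc|->]; rewrite ?normc0. Qed.

Lemma normc_gt0 z : z != 0 -> 0 < normc z.
Proof.
move=> z0; rewrite lt_neqAle normc_ge0 andbT eq_sym.
by apply: contra z0 => /eqP/normc_eq0P ->.
Qed.

Lemma normc_real (a : R) : normc a%:C%C = `|a|.
Proof. by rewrite /= expr0n addr0 sqrtr_sqr. Qed.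

Lemma normcB z w t : normc (z - t) <= normc (z - w) + normc (w - t).
Proof. by apply: le_trans (normcD _ _); rewrite addrA subrK. Qed.

Lemma normc_sum (I : Type) (s : seq I) (F : I -> cplx R) :
  normc (\sum_(i <- s) F i) <= \sum_(i <- s) normc (F i).
Proof.
elim: s => [|i s IH]; first by rewrite !big_nil normc0.
by rewrite !big_cons (le_trans (normcD _ _)) // lerD2l.
Qed.

Lemma Re_le_normc z : `|complex.Re z| <= normc z.
Proof.
case: z => a b /=; rewrite -sqrtr_sqr ler_sqrt ?addr_ge0 ?sqr_ge0 //.
by rewrite lerDl sqr_ge0.
Qed.

Lemma Im_le_normc z : `|complex.Im z| <= normc z.
Proof.
case: z => a b /=; rewrite -sqrtr_sqr ler_sqrt ?addr_ge0 ?sqr_ge0 //.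
by rewrite lerDr sqr_ge0.
Qed.

Lemma normc_le_ReIm z : normc z <= `|complex.Re z| + `|complex.Im z|.
Proof.
rewrite [in leLHS](complexE z) (le_trans (normcD _ _)) // normcM !normc_real.
by rewrite lerD2l /= expr0n expr1n add0r sqrtr1 mul1r.
Qed.

Lemma normc_conj z : normc (conjc z) = normc z.
Proof. by case: z => a b /=; rewrite sqrrN. Qed.

Lemma mulc_conj z : z * conjc z = ((normc z) ^+ 2)%:C%C.
Proof.
case: z => a b /=; rewrite sqr_sqrtr ?addr_ge0 ?sqr_ge0 //.
by rewrite -[_ * _]/(_ +i* _)%C; congr (_ +i* _)%C; ring.
Qed.

Lemma normc_natr n : normc (n%:R : cplx R) = n%:R.
Proof. by rewrite -(rmorph_nat (real_complex R)) normc_real ger0_norm. Qed.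

Lemma conjc_add z w : conjc (z + w) = conjc z + conjc w :> cplx R.
Proof. exact: (rmorphD (@conjc R)). Qed.

Lemma conjc_mul z w : conjc (z * w) = conjc z * conjc w :> cplx R.
Proof. exact: (rmorphM (@conjc R)). Qed.

(** Used to derive equalities from approximations of arbitrary precision. *)
Lemma normc_le_small z : (forall e : R, 0 < e -> normc z <= e) -> z = 0.
Proof.
move=> H; apply/normc_eq0P/eqP; rewrite eq_le normc_ge0 andbT.
by apply/ler_addgt0Pl => e e0; rewrite addr0; exact: H.
Qed.

End NormC.

Section ContinuityCriterion.
Variables (R : realType) (X : topologicalType).
Implicit Types f g : X -> cplx R.

(** Balls of [cplx R] have complex radii for a complex-valued norm; real radii
    allow arithmetic in a totally ordered field. *)
Lemma cvgcP (I : Type) (F : set_system I) {FF : Filter F} (f : I -> cplx R) l :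
  (f @ F --> l) <-> forall e : R, 0 < e -> \forall z \near F, normc (f z - l) < e.
Proof.
split.
- move=> /cvgrPdistC_lt H e e0.
  have := H e%:C%C; rewrite ltcR => /(_ e0); apply: filterS => z.
  by rewrite normcE ltcR.
- move=> H; apply/cvgrPdistC_lt => e; rewrite ltcE /= => /andP[/eqP e1 e2].
  near=> z; rewrite normcE ltcE /= e1 eqxx /=.
  by near: z; exact: H.
Unshelve. all: by end_near. Qed.

Lemma continuouscP f : continuous f <->
  forall x (e : R), 0 < e -> \forall z \near x, normc (f z - f x) < e.
Proof. by split=> H x; [apply/cvgcP/H|apply/cvgcP; exact: H]. Qed.

End ContinuityCriterion.

Section ContinuousComplexFunctions.
Variables (R : realType) (X : topologicalType).
Implicit Types f g : X -> cplx R.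

Lemma ccont_cst (c : cplx R) : continuous (fun _ : X => c).
Proof. by move=> x; exact: cvg_cst. Qed.

Lemma ccontD f g : continuous f -> continuous g -> continuous (fun x => f x + g x).
Proof. by move=> cf cg x; apply: (@continuousD _ _ _ f g x); [exact: cf|exact: cg]. Qed.

Lemma ccontM f g : continuous f -> continuous g -> continuous (fun x => f x * g x).
Proof. by move=> cf cg x; apply: (@continuousM _ _ f g x); [exact: cf|exact: cg]. Qed.

Lemma ccontN f : continuous f -> continuous (fun x => - f x).
Proof. by move=> cf x; apply: (@continuousN _ _ _ f x); exact: cf. Qed.

Lemma ccont_conj f : continuous f -> continuous (fun x => conjc (f x) : cplx R).
Proof.
move=> /continuouscP cf; apply/continuouscP => x e e0.
apply: filterS (cf x e e0) => z.
by rewrite -(normc_conj (f z - f x)) (rmorphB (@conjc R)).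
Qed.

Lemma cont_Re f : continuous f -> continuous (fun x => complex.Re (f x) : R).
Proof.
move=> /continuouscP cf x; apply/cvgrPdistC_lt => e e0.
apply: filterS (cf x e e0) => z; apply: le_lt_trans.
by rewrite -(raddfB (@complex.Re R : Rcomplex R -> R)) Re_le_normc.
Qed.

Lemma cont_Im f : continuous f -> continuous (fun x => complex.Im (f x) : R).
Proof.
move=> /continuouscP cf x; apply/cvgrPdistC_lt => e e0.
apply: filterS (cf x e e0) => z; apply: le_lt_trans.
by rewrite -(raddfB (@complex.Im R : Rcomplex R -> R)) Im_le_normc.
Qed.

Lemma ccont_real (u : X -> R) : continuous u -> continuous (fun x => (u x)%:C%C : cplx R).
Proof.
move=> cu; apply/continuouscP => x e e0.
have /cvgrPdistC_lt/(_ e e0) := cu x.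
by apply: filterS => z; rewrite -rmorphB normc_real.
Qed.

Lemma cont_normc f : continuous f -> continuous (fun x => normc (f x) : R).
Proof.
move=> /continuouscP cf x; apply/cvgrPdistC_lt => e e0.
apply: filterS (cf x e e0) => z; apply: le_lt_trans.
rewrite ler_norml; apply/andP; split.
  by have := normcB (f x) (f z) 0; rewrite !subr0 normc_distC; lra.
by have := normcB (f z) (f x) 0; rewrite !subr0; lra.
Qed.

Lemma ccont_sum (I : Type) (s : seq I) (F : I -> X -> cplx R) :
  (forall i, continuous (F i)) -> continuous (fun x => \sum_(i <- s) F i x).
Proof.
move=> cF; elim: s => [|i s IH].
  have -> : (fun x => \sum_(i <- [::]) F i x) = fun=> 0.
    by apply/funext => x; rewrite big_nil.
  exact: ccont_cst.
have -> : (fun x => \sum_(j <- i :: s) F j x) = fun x => F i x + \sum_(j <- s) F j x.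
  by apply/funext => x; rewrite big_cons.
by apply: ccontD; [exact: cF|exact: IH].
Qed.

Lemma ccont_unif f :
  (forall e : R, 0 < e -> exists2 g : X -> cplx R, continuous g &
     forall x, normc (f x - g x) <= e) -> continuous f.
Proof.
move=> H; apply/continuouscP => x e e0.
have e3 : 0 < e / 4%:R by lra.
have [g /continuouscP cg fg] := H _ e3.
apply: filterS (cg x _ e3) => z gz.
have := normcB (f z) (g z) (f x); have := normcB (g z) (g x) (f x).
by have := fg z; have := fg x; rewrite (normc_distC (f x)); lra.
Qed.

End ContinuousComplexFunctions.

Section CauchyCompleteness.
Variable R : realType.

Lemma cauchy_real (u : nat -> R) :
  (forall e : R, 0 < e -> exists N, forall n, (N <= n)%N -> `|u n - u N| <= e) ->
  exists l, forall e : R, 0 < e -> exists N, forall n, (N <= n)%N -> `|u n - l| <= e.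
Proof.
move=> H.
have cu : cvgn u.
  apply/cauchy_cvgP/cauchy_exP => e e0.
  have [N HN] := H (e / 2) ltac:(lra).
  exists (u N); exists N => // n /= Nn; rewrite /ball /= distrC.
  by have := HN n Nn; lra.
exists (limn u) => e e0.
have /cvgrPdistC_lt/(_ e e0) [N _ HN] := cu.
by exists N => n Nn; apply: ltW; exact: HN.
Qed.

Lemma cauchy_complex (u : nat -> cplx R) :
  (forall e : R, 0 < e -> exists N, forall n, (N <= n)%N -> normc (u n - u N) <= e) ->
  exists l, forall e : R, 0 < e -> exists N, forall n, (N <= n)%N -> normc (u n - l) <= e.
Proof.
move=> H.
have [a Ha] : exists l, forall e : R, 0 < e ->
    exists N, forall n, (N <= n)%N -> `|complex.Re (u n) - l| <= e.
  apply: cauchy_real => e e0; have [N HN] := H e e0; exists N => n Nn.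
  apply: le_trans (HN n Nn).
  by rewrite -(raddfB (@complex.Re R : Rcomplex R -> R)) Re_le_normc.
have [b Hb] : exists l, forall e : R, 0 < e ->
    exists N, forall n, (N <= n)%N -> `|complex.Im (u n) - l| <= e.
  apply: cauchy_real => e e0; have [N HN] := H e e0; exists N => n Nn.
  apply: le_trans (HN n Nn).
  by rewrite -(raddfB (@complex.Im R : Rcomplex R -> R)) Im_le_normc.
exists (a +i* b)%C => e e0.
have [N HN] := Ha (e / 2) ltac:(lra); have [M HM] := Hb (e / 2) ltac:(lra).
exists (maxn N M) => n; rewrite geq_max => /andP[Nn Mn].
apply: le_trans (normc_le_ReIm _) _.
rewrite (raddfB (@complex.Re R : Rcomplex R -> R)) (raddfB (@complex.Im R : Rcomplex R -> R)) /=.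
by have := HN n Nn; have := HM n Mn; lra.
Qed.

End CauchyCompleteness.

(** * The Stone-Weierstrass theorem *)

Section CompactSelect.
Variables (X : topologicalType) (Xcompact : compact [set: X]).

(** Local solutions of a condition [P] glue to a global one when [L] is
    directed for [P]: the sets of elements of [L] above a given one form a
    filter base, along which the local conditions hold eventually, hence, by
    compactness, uniformly. *)
Lemma compact_select (S : Type) (L : set S) (P : S -> X -> Prop) :
  L !=set0 ->
  (forall g h, L g -> L h ->
     exists2 k, L k & forall z, P g z \/ P h z -> P k z) ->
  (forall x : X, exists2 g, L g & \forall z \near x, P g z) ->
  exists2 g, L g & forall z, P g z.
Proof.
move=> L0 Ldir Lloc.
pose up g := [set h | L h /\ forall z, P g z -> P h z].
have FF : Filter (filter_from L up).
  apply: filter_from_filter => // g h Lg Lh.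
  have [k Lk Pk] := Ldir g h Lg Lh; exists k => // m [Lm Pm].
  by split; split=> // z ?; apply/Pm/Pk; [left|right].
move/compact_near_coveringP: Xcompact => /(_ _ _ P FF) [].
  move=> x _; have [g Lg Pg] := Lloc x.
  exists ([set z | P g z], up g) => /=; first by split=> //; exists g.
  by move=> [z h] /= [gz [_ gh]]; exact: gh.
move=> g Lg gP; exists g => // z.
by apply: (gP g) => //; split.
Qed.

Lemma compact_bounded_fun (R : realType) (f : X -> R) :
  continuous f -> exists2 K, 0 < K & forall x, `|f x| <= K.
Proof.
move=> cf; apply: (@compact_select R [set K | 0 < K] (fun K x => `|f x| <= K)).
- by exists 1 => /=.
- move=> g h /= g0 h0; exists (g + h); first exact: addr_gt0.
  by move=> z [] H; apply: le_trans H _; rewrite ?lerDl ?lerDr ltW.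
- move=> x; exists (`|f x| + 1); first by rewrite /= ltr_wpDl.
  have /cvgrPdistC_lt/(_ 1 ltr01) := cf x; apply: filterS => z fz.
  by have := ler_normD (f z - f x) (f x); rewrite subrK; lra.
Qed.

End CompactSelect.

Section RealStoneWeierstrass.
Variables (R : realType) (X : topologicalType) (Xcompact : compact [set: X]).
Variable A : set (X -> R).
Hypothesis Acont : forall f, A f -> continuous f.
Hypothesis Acst : forall c : R, A (fun _ => c).
Hypothesis AD : forall f g, A f -> A g -> A (fun x => f x + g x).
Hypothesis AM : forall f g, A f -> A g -> A (fun x => f x * g x).

Definition uclosure : set (X -> R) :=
  [set f | forall e : R, 0 < e -> exists2 g, A g & forall x, `|f x - g x| <= e].

Lemma sub_uclosure f : A f -> uclosure f.
Proof. by move=> Af e e0; exists f => // x; rewrite subrr normr0 ltW. Qed.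

Lemma uclosure_cont f : uclosure f -> continuous f.
Proof.
move=> uf x; apply/cvgrPdistC_lt => e e0.
have [g /Acont cg fg] := uf (e / 4%:R) ltac:(lra).
have /cvgrPdistC_lt/(_ (e / 4%:R) ltac:(lra)) := cg x.
apply: filterS => z gz.
have := ler_normD (f z - g z) (g z - g x + (g x - f x)).
have := ler_normD (g z - g x) (g x - f x).
have := fg x; have := fg z; rewrite (distrC (f x)).
have -> : f z - g z + (g z - g x + (g x - f x)) = f z - f x by ring.
lra.
Qed.

(** The iteration [p <- p + (t^2 - p^2) / 2] for the square root of [t^2]; it
    increases to [|t|] when [|t| <= 1]. *)
Fixpoint abs_poly (n : nat) (t : R) : R :=
  if n is n'.+1 then abs_poly n' t + (t ^+ 2 - abs_poly n' t ^+ 2) / 2 else 0.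

Lemma abs_poly_bound n t : `|t| <= 1 ->
  0 <= abs_poly n t <= `|t| /\ `|t| - abs_poly n t <= `|t| * (1 - `|t| / 2) ^+ n.
Proof.
move=> t1; elim: n => [|n [/andP[IH1 IH2] IH3]] /=.
  by split; rewrite ?expr0 ?mulr1 ?subr0 ?lexx ?normr_ge0.
rewrite -(real_normK (num_real t)); move: (abs_poly n t) IH1 IH2 IH3 => p.
move: (`|t|) (normr_ge0 t) t1 => s s0 s1 p0 ps H.
have E : s - (p + (s ^+ 2 - p ^+ 2) / 2) = (s - p) * (1 - (s + p) / 2) by field.
have sp : 0 <= s - p by lra.
split.
  apply/andP; split; first by nra.
  by rewrite -subr_ge0 E mulr_ge0 //; lra.
rewrite E exprS mulrCA mulrC ler_pM //; lra.
Qed.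

Lemma abs_poly_approx (e : R) : 0 < e ->
  exists n, forall t, `|t| <= 1 -> `| `|t| - abs_poly n t| <= e.
Proof.
move=> e0; pose n := (Num.truncn (2 / e)).+1; exists n => t t1.
have [/andP[p0 pt] H] := abs_poly_bound n t1.
rewrite ger0_norm ?subr_ge0 // (le_trans H) //.
move: (`|t|) (normr_ge0 t) t1 => s s0 s1 {H p0 pt}.
have n2 : 2 / e < n%:R by rewrite /n truncnS_gt //; lra.
(* As 2 / e < n, it is enough that n * s * (1 - s / 2)^n <= 2, which follows
   from the inequality of Bernoulli for (1 + s / 2)^n. *)
have bern : (1 - s / 2) ^+ n * (1 + n%:R * (s / 2)) <= 1.
  apply: (@le_trans _ _ ((1 - s / 2) ^+ n * (1 + s / 2) ^+ n)).
    rewrite ler_wpM2l ?exprn_ge0 //; first lra.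
    elim: n {n2} => [|n IH]; first by rewrite mul0r addr0 expr0.
    rewrite exprS -natr1; have : 0 <= (n%:R : R) by []; nra.
  rewrite -exprMn exprn_ile1 //; nra.
have q0 : 0 <= (1 - s / 2) ^+ n by rewrite exprn_ge0 //; lra.
have n0 : 0 < (n%:R : R) by [].
have h : 2 < n%:R * e by rewrite -ltr_pdivrMr.
move: ((1 - s / 2) ^+ n) q0 bern => q q0 bern.
have : n%:R * (s * q) <= 2 by nra.
move=> H; rewrite -(ler_pM2l n0); lra.
Qed.

Lemma abs_poly_mem n f : A f -> A (fun x => abs_poly n (f x)).
Proof.
move=> Af; elim: n => [|n IH] /=; first exact: Acst.
apply: AD => //.
have -> : (fun x => (f x ^+ 2 - abs_poly n (f x) ^+ 2) / 2) =
  (fun x => (f x * f x + (-1) * (abs_poly n (f x) * abs_poly n (f x))) * 2^-1).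
  by apply/funext => x; ring.
by apply: AM => //; apply: AD; apply: AM => //; apply: AM.
Qed.

Lemma uclosure_abs f : A f -> uclosure (fun x => `|f x|).
Proof.
move=> Af e e0; have [K K0 fK] := compact_bounded_fun Xcompact (Acont Af).
have [n Hn] := abs_poly_approx (divr_gt0 e0 K0).
exists (fun x => K * abs_poly n (K^-1 * f x)).
  by apply: AM => //; apply: abs_poly_mem; exact: AM.
move=> x; have t1 : `|K^-1 * f x| <= 1.
  by rewrite normrM gtr0_norm ?invr_gt0 // mulrC ler_pdivrMr // mul1r.
have := Hn _ t1; rewrite -(ler_pM2l K0) mulrCA divff ?gt_eqF // mulr1.
apply: le_trans; rewrite -[K in K * `| _ |]gtr0_norm // -normrM mulrBr.
by rewrite normrM (gtr0_norm (_ : 0 < K^-1)) ?invr_gt0 // mulrA divff ?gt_eqF // mul1r.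
Qed.

(** The maximum and the minimum of two numbers are half of their sum, plus or
    minus the absolute value of their difference. *)
Lemma uclosure_maxmin f g (s : bool) : uclosure f -> uclosure g ->
  uclosure (fun x => if s then Num.max (f x) (g x) else Num.min (f x) (g x)).
Proof.
move=> uf ug e e0.
have [a Aa fa] := uf (e / 4%:R) ltac:(lra).
have [b Ab gb] := ug (e / 4%:R) ltac:(lra).
have Ad : A (fun x => a x + (-1) * b x) by apply: AD => //; exact: AM.
have [h Ah dh] := uclosure_abs Ad (e := e / 4%:R) ltac:(lra).
exists (fun x => (a x + (b x + (if s then 1 else -1) * h x)) * 2^-1).
  by apply: AM => //; apply: AD => //; apply: AD => //; apply: AM.
move=> x; have := fa x; have := gb x; have := dh x; rewrite !ler_norml.
move=> /andP[d1 d2] /andP[b1 b2] /andP[a1 a2]; apply/andP.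
move: d1 d2; rewrite /= mulN1r; case: s => /=; case: (lerP (f x) (g x)) => fg; case: (ger0P (a x - b x)) => ab;
 move=> d1 d2; split; lra.
Qed.

(** The lattice argument: with [x] fixed, the maximum of finitely many
    functions that agree with [f] at [x] and at another point lies above
    [f - e / 2] and still agrees with [f] at [x]; the minimum of finitely many
    of those lies within [e / 2] of [f]. *)
Theorem real_stone_weierstrass f : continuous f ->
  (forall x y, exists g, [/\ A g, g x = f x & g y = f y]) -> uclosure f.
Proof.
move=> cf sep e e0.
have near_gt g x (k : R) : continuous g -> f x - k < g x -> \forall z \near x, f z - k < g z.
  move=> cg H.
  have /cvgrPdistC_lt/(_ ((g x - f x + k) / 2) ltac:(lra)) := cg x.
  have /cvgrPdistC_lt/(_ ((g x - f x + k) / 2) ltac:(lra)) := cf x.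
  apply: filterS2 => z; rewrite !ltr_norml => /andP[? ?] /andP[? ?]; lra.
have near_lt g x (k : R) : continuous g -> g x < f x + k -> \forall z \near x, g z < f z + k.
  move=> cg H.
  have /cvgrPdistC_lt/(_ ((f x + k - g x) / 2) ltac:(lra)) := cg x.
  have /cvgrPdistC_lt/(_ ((f x + k - g x) / 2) ltac:(lra)) := cf x.
  apply: filterS2 => z; rewrite !ltr_norml => /andP[? ?] /andP[? ?]; lra.
have above x : exists2 g, uclosure g /\ g x = f x & forall z, f z - e / 2 < g z.
  apply: (compact_select Xcompact (L := [set g | uclosure g /\ g x = f x])
                     (P := fun g z => f z - e / 2 < g z)).
  - by have [g [Ag gx _]] := sep x x; exists g; split=> //; exact: sub_uclosure.
  - move=> g h [ug gx] [uh hx]; exists (fun z => Num.max (g z) (h z)).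
      by split; [exact: (uclosure_maxmin true)|rewrite gx hx maxxx].
    by move=> z; rewrite lt_max => -[->|->]; rewrite ?orbT.
  - move=> y; have [g [Ag gx gy]] := sep x y; exists g.
      by split=> //; exact: sub_uclosure.
    by apply: near_gt; [exact: Acont|rewrite gy; lra].
have [g [ug g1] g2] : exists2 g, uclosure g /\ (forall z, f z - e / 2 < g z) &
    forall z, g z < f z + e / 2.
  apply: (compact_select Xcompact (L := [set g | uclosure g /\ (forall z, f z - e / 2 < g z)])
                     (P := fun g z => g z < f z + e / 2)).
  - have [[x _]|X0] := pselect ([set: X] !=set0).
      by have [g [ug _] H] := above x; exists g.
    exists (fun=> 0); split; first exact/sub_uclosure/Acst.
    by move=> z; case: X0; exists z.
  - move=> g h [ug g1] [uh h1]; exists (fun z => Num.min (g z) (h z)).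
      split; first exact: (uclosure_maxmin false).
      by move=> z; rewrite lt_min g1 h1.
    by move=> z; rewrite gt_min => -[->|->]; rewrite ?orbT.
  - move=> x; have [g [ug gx] H] := above x; exists g; first by split.
    by apply: near_lt; [exact: uclosure_cont|rewrite gx; lra].
have [h Ah gh] := ug (e / 2) ltac:(lra); exists h => // x.
have := gh x; have := g1 x; have := g2 x; rewrite !ler_norml => ? ? /andP[? ?].
apply/andP; split; lra.
Qed.

End RealStoneWeierstrass.

Section ComplexStoneWeierstrass.
Variables (R : realType) (X : topologicalType) (Xcompact : compact [set: X]).
Variable A : set (X -> cplx R).
Hypothesis Acont : forall f, A f -> continuous f.
Hypothesis Acst : forall c : cplx R, A (fun _ => c).
Hypothesis AD : forall f g, A f -> A g -> A (fun x => f x + g x).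
Hypothesis AM : forall f g, A f -> A g -> A (fun x => f x * g x).
Hypothesis Aconj : forall f, A f -> A (fun x => conjc (f x)).
Hypothesis Asep : forall x y, x != y -> exists2 f, A f & f x != f y.

Let realA : set (X -> R) := [set u | A (fun x => (u x)%:C%C)].

Let realA_Re f : A f -> realA (fun x => complex.Re (f x)).
Proof.
move=> Af; rewrite /realA /=.
have -> : (fun x => (complex.Re (f x))%:C%C : cplx R) =
          (fun x => (f x + conjc (f x)) * (2^-1)%:C%C).
  apply/funext => x; by case: (f x) => a b; simpc; congr (_ +i* _)%C => /=; field.
by apply: AM => //; apply: AD => //; exact: Aconj.
Qed.

Let realA_Im f : A f -> realA (fun x => complex.Im (f x)).
Proof.
move=> Af.
have := realA_Re (AM (Acst (- 'i%C)) Af); congr realA.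
by apply/funext => x; case: (f x) => a b; simpc.
Qed.

(** A subalgebra stable under conjugation contains the real and the imaginary
    parts of its members, and the real theorem applies to each of them. *)
Lemma stone_weierstrass f : continuous f -> forall e : R, 0 < e ->
  exists2 g, A g & forall x, normc (f x - g x) <= e.
Proof.
move=> cf.
have realA_cont u : realA u -> continuous u by move=> /Acont/cont_Re.
have realA_cst (c : R) : realA (fun=> c) by exact: Acst.
have realAD u v : realA u -> realA v -> realA (fun x => u x + v x).
  move=> Au Av; have := AD Au Av; congr A.
  by apply/funext => x; rewrite -rmorphD.
have realAM u v : realA u -> realA v -> realA (fun x => u x * v x).
  move=> Au Av; have := AM Au Av; congr A.
  by apply/funext => x; rewrite -rmorphM.
have sep (h : X -> R) x y : exists g, [/\ realA g, g x = h x & g y = h y].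
  have [<-|xy] := eqVneq x y; first by exists (fun=> h x).
  have [u Au uxy] : exists2 u, realA u & u x != u y.
    have [g Ag gxy] := Asep xy.
    have [E|?] := eqVneq (complex.Re (g x)) (complex.Re (g y)); last first.
      by exists (fun z => complex.Re (g z)) => //; exact: realA_Re.
    exists (fun z => complex.Im (g z)); first exact: realA_Im.
    by apply: contra gxy => /eqP E'; rewrite eq_complex E E' !eqxx.
  pose b := (h x - h y) / (u x - u y).
  exists (fun z => (h x - b * u x) + b * u z); split.
  - by apply: realAD => //; exact: realAM.
  - by rewrite subrK.
  - have : u x - u y != 0 by rewrite subr_eq0.
    by rewrite /b => ?; field.
have SW u : continuous u -> uclosure realA u.
  by move=> cu; apply: real_stone_weierstrass => // x y; exact: sep.
move=> e e0.
have [g Ag fg] := SW _ (cont_Re cf) (e / 2) ltac:(lra).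
have [h Ah fh] := SW _ (cont_Im cf) (e / 2) ltac:(lra).
exists (fun x => (g x)%:C%C + 'i%C * (h x)%:C%C).
  by apply: AD => //; exact: AM.
move=> x; apply: le_trans (normc_le_ReIm _) _.
have := fg x; have := fh x; case: (f x) => a b /=; simpc => /=; lra.
Qed.

End ComplexStoneWeierstrass.

(** * The Haar mean of a compact abelian group *)

Section TranslateAverages.
Variables (R : realType) (X : zmodType).
Implicit Types (s t : seq X) (f g : X -> cplx R).

Definition avg s f (x : X) : cplx R := (size s)%:R^-1 * \sum_(y <- s) f (x + y).

Lemma size_neq0 s : s != [::] -> (size s)%:R != 0 :> cplx R.
Proof.
by move=> s0; rewrite (pnatr_eq0 (R[i])) size_eq0.
Qed.

Lemma avg_cst s c x : s != [::] -> avg s (fun=> c) x = c.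
Proof.
move=> s0; rewrite /avg big_const_seq count_predT iter_addr_0 -[c *+ _]mulr_natl.
by rewrite mulrA mulVf ?mul1r ?size_neq0.
Qed.

Lemma avgD s f g x : avg s (fun z => f z + g z) x = avg s f x + avg s g x.
Proof. by rewrite /avg big_split mulrDr. Qed.

Lemma avgZ s (a : cplx R) f x : avg s (fun z => a * f z) x = a * avg s f x.
Proof. by rewrite /avg -mulr_sumr mulrCA. Qed.

Lemma avg_avg s t f x :
  avg s (avg t f) x = avg [seq y + z | y <- s, z <- t] f x.
Proof.
rewrite /avg -mulr_sumr size_allpairs natrM invfM -mulrA; congr (_ * (_ * _)).
rewrite big_allpairs_dep; apply: eq_bigr => y _; apply: eq_bigr => z _.
by rewrite addrA.
Qed.

Lemma avgC s t f x : avg s (avg t f) x = avg t (avg s f) x.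
Proof.
rewrite /avg -!mulr_sumr mulrCA; congr (_ * (_ * _)); rewrite exchange_big.
by apply: eq_bigr => y _; apply: eq_bigr => z _; rewrite addrAC.
Qed.

Lemma avg_le s f x (K : R) : s != [::] -> (forall x, normc (f x) <= K) ->
  normc (avg s f x) <= K.
Proof.
move=> s0 fK; rewrite /avg normcM normcV normc_natr.
have k0 : 0 < (size s)%:R :> R by rewrite ltr0n lt0n size_eq0.
rewrite mulrC ler_pdivrMr // (le_trans (normc_sum _ _)) //.
apply: (@le_trans _ _ (\sum_(y <- s) K)); first by apply: ler_sum.
by rewrite big_const_seq count_predT iter_addr_0 mulr_natr.
Qed.

Lemma avg_close s f c x (e : R) : s != [::] -> (forall x, normc (f x - c) <= e) ->
  normc (avg s f x - c) <= e.
Proof.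
move=> s0 H; rewrite -[c in leLHS](@avg_cst s c x s0) -mulN1r -avgZ -avgD.
by apply: avg_le => // y; rewrite mulN1r.
Qed.

Lemma avg_osc s f (e : R) : s != [::] -> (forall x y, normc (f x - f y) <= e) ->
  forall x y, normc (avg s f x - f y) <= e.
Proof. by move=> s0 H x y; apply: avg_close. Qed.

Lemma avg_avg_close s t f (d e : R) x y : s != [::] -> t != [::] ->
  (forall x y, normc (avg s f x - avg s f y) <= d) ->
  (forall x y, normc (avg t f x - avg t f y) <= e) ->
  normc (avg s f x - avg t f y) <= d + e.
Proof.
move=> s0 t0 Hs Ht; apply: le_trans (normcB _ (avg t (avg s f) 0) _) _.
rewrite lerD //; first by rewrite normc_distC; exact: avg_osc.
by rewrite -avgC; exact: avg_osc.
Qed.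

Lemma sum_close (s t : seq X) (F G : X -> cplx R) (D : R) : size s = size t ->
  (forall x y, normc (F x - G y) <= D) ->
  normc (\sum_(x <- s) F x - \sum_(y <- t) G y) <= (size s)%:R * D.
Proof.
move=> + H; elim: s t => [|x s IH] [|y t] //=.
  by move=> _; rewrite !big_nil subrr normc0 mul0r.
move=> [/IH {}IH]; rewrite !big_cons opprD addrACA -natr1 mulrDl mul1r addrC.
by rewrite (le_trans (normcD _ _)) // lerD.
Qed.

(** After reordering, the two sums have one pair of terms that differ by a
    translation in [V], hence by at most [e]; the other pairs differ by at most
    the oscillation [e + D] of [f]. *)
Lemma avg_contract s (V : set X) f (e D : R) :
  s != [::] -> (forall x, exists2 y, y \in s & V (x - y)) ->
  (forall x v, V v -> normc (f (x + v) - f x) <= e) ->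
  (forall x y, normc (f x - f y) <= e + D) ->
  forall x y, normc (avg s f x - avg s f y) <= e + (1 - (size s)%:R^-1) * D.
Proof.
move=> s0 Vs fV fD x y; case: s s0 Vs => // a s _ Vs.
have [b bs Vb] := Vs (x + a - y).
rewrite /avg -mulrBr normcM normcV normc_natr.
set k := size (a :: s).
have k0 : 0 < k%:R :> R by rewrite ltr0n.
(* [x + a] is matched with [y + b], where [b] is chosen so that the two points
   differ by an element of [V]. *)
rewrite mulrC ler_pdivrMr // big_cons (big_rem b bs) /= opprD addrACA.
apply: le_trans (normcD _ _) _.
have E : x + a = (y + b) + (x + a - y - b) by rewrite -(addrA (x + a)) -opprD [RHS]addrC subrK.
have H1 : normc (f (x + a) - f (y + b)) <= e by rewrite {1}E; exact: fV.
have sz : size s = size (seq.rem b (a :: s)) by rewrite size_rem.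
have H2 := @sum_close s (seq.rem b (a :: s)) (fun z => f (x + z)) (fun z => f (y + z))
   (e + D) sz (fun z w => fD (x + z) (y + w)).
apply: le_trans (lerD H1 H2) _.
rewrite mulrDl mulrAC mulrBl mul1r mulVf ?gt_eqF // /k /= -natr1; lra.
Qed.

End TranslateAverages.

(** Joint continuity gives continuity in the parameter, uniformly over the
    compact factor. *)
Lemma uniform_near_param (R : realType) (X Y : topologicalType) (Xcompact : compact [set: X]) (F : Y * X -> cplx R) (y0 : Y) (e : R) :
  continuous F -> 0 < e -> \forall y \near y0, forall x, normc (F (y, x) - F (y0, x)) <= e.
Proof.
move=> /continuouscP cF e0.
have H : \forall y \near y0, [set: X] `<=` (fun x => normc (F (y, x) - F (y0, x)) <= e).
  move/compact_near_coveringP: Xcompact; apply=> x _.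
  have [[/= U V] [Ux Vy] UV] := cF (y0, x) (e / 2) ltac:(lra).
  exists (V, U) => //= -[x' y'] /= [Vx Uy].
  have H1 := UV (y', x') (conj Uy Vx).
  have H2 := UV (y0, x') (conj (nbhs_singleton Ux) Vx).
  move: H1 H2 => /= H1 H2; apply: le_trans (normcB _ (F (y0, x)) _) _.
  rewrite (normc_distC (F (y0, x))); lra.
by apply: filterS H => y H x; exact: H.
Qed.

Section Mean.
Variables (R : realType) (X : topologicalZmodType).
Implicit Types (s t : seq X) (f g : X -> cplx R).

(** The Haar integral of [f], characterised without measure theory. *)
Definition is_mean f (c : cplx R) := forall e : R, 0 < e ->
  exists2 s, s != [::] & forall x, normc (avg s f x - c) <= e.

(** Averaging operators commute, so that two of them can be refined into a
    common one. *)
Lemma is_mean_uniq f c d : is_mean f c -> is_mean f d -> c = d.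
Proof.
move=> Hc Hd; apply/eqP; rewrite -subr_eq0; apply/eqP/normc_le_small => e e0.
have [s s0 Hs] := Hc (e / 2) ltac:(lra); have [t t0 Ht] := Hd (e / 2) ltac:(lra).
have H1 : normc (avg t (avg s f) 0 - c) <= e / 2 by exact: avg_close.
have H2 : normc (avg t (avg s f) 0 - d) <= e / 2 by rewrite avgC; exact: avg_close.
by have := normcB c (avg t (avg s f) 0) d; rewrite (normc_distC c (avg _ _ _)); lra.
Qed.

Lemma is_mean_cst c : is_mean (fun=> c) c.
Proof.
move=> e e0; exists [:: 0] => // x.
by rewrite avg_cst // subrr normc0 ltW.
Qed.

Lemma is_mean_avg s f c : s != [::] -> is_mean f c -> is_mean (avg s f) c.
Proof.
move=> s0 H e e0; have [t t0 Ht] := H e e0; exists t => // x.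
by rewrite avgC; exact: avg_close.
Qed.

Lemma avg_refine s t f c (e : R) : s != [::] -> t != [::] ->
  (forall x, normc (avg s f x - c) <= e) ->
  forall x, normc (avg [seq y + z | y <- t, z <- s] f x - c) <= e.
Proof. by move=> s0 t0 Hs x; rewrite -avg_avg; exact: avg_close. Qed.

Lemma allpairs_neq0 s t : s != [::] -> t != [::] -> [seq y + z | y <- s, z <- t] != [::].
Proof. by rewrite -!size_eq0 size_allpairs muln_eq0 => /negPf -> /negPf ->. Qed.

Lemma is_meanD f g c d : is_mean f c -> is_mean g d ->
  is_mean (fun x => f x + g x) (c + d).
Proof.
move=> Hc Hd e e0.
have [s s0 Hs] := Hc (e / 2) ltac:(lra); have [t t0 Ht] := Hd (e / 2) ltac:(lra).
exists [seq y + z | y <- s, z <- t]; first exact: allpairs_neq0.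
move=> x; rewrite avgD opprD addrACA (le_trans (normcD _ _)) //.
have := avg_refine t0 s0 Ht x; rewrite -!avg_avg => H1.
have H2 : normc (avg s (avg t f) x - c) <= e / 2 by rewrite avgC; exact: avg_close.
lra.
Qed.

Lemma is_meanZ (a : cplx R) f c : is_mean f c -> is_mean (fun x => a * f x) (a * c).
Proof.
move=> Hc e e0; have a0 := normc_ge0 a.
have [s s0 Hs] := Hc (e / (normc a + 1)) ltac:(by apply: divr_gt0; lra).
exists s => // x; rewrite avgZ -mulrBr normcM.
have := Hs x; rewrite ler_pdivlMr; last lra.
by have := normc_ge0 (avg s f x - c); nra.
Qed.

Lemma is_mean_conj f c : is_mean f c -> is_mean (fun x => conjc (f x)) (conjc c).
Proof.
move=> Hc e e0; have [s s0 Hs] := Hc e e0; exists s => // x.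
have -> : avg s (fun y => conjc (f y) : cplx R) x = conjc (avg s f x).
  by rewrite /avg (rmorphM (@conjc R)) fmorphV rmorph_nat (raddf_sum (@conjc R)).
by rewrite -(rmorphB (@conjc R)) normc_conj.
Qed.

Lemma is_mean_shift a f c : is_mean f c -> is_mean (fun x => f (x + a)) c.
Proof.
move=> Hc e e0; have [s s0 Hs] := Hc e e0; exists s => // x.
suff -> : avg s (fun x => f (x + a)) x = avg s f (x + a) by [].
by rewrite /avg; congr (_ * _); apply: eq_bigr => y _; rewrite addrAC.
Qed.

Lemma is_mean_opp f c : is_mean f c -> is_mean (fun x => f (- x)) c.
Proof.
move=> Hc e e0; have [s s0 Hs] := Hc e e0; exists (map -%R s); first by case: (s) s0.
move=> x; suff -> : avg (map -%R s) (fun x => f (- x)) x = avg s f (- x) by [].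
rewrite /avg size_map big_map; congr (_ * _); apply: eq_bigr => y _.
by rewrite opprD opprK.
Qed.

Lemma is_mean_le f c (K : R) : (forall x, normc (f x) <= K) -> is_mean f c -> normc c <= K.
Proof.
move=> fK Hc; apply/ler_addgt0Pl => e e0; have [s s0 Hs] := Hc e e0.
have := normcB c (avg s f 0) 0; rewrite !subr0 => H.
have := Hs 0; rewrite normc_distC; have := avg_le 0 s0 fK; lra.
Qed.

Lemma is_mean_ge f c (K : R) : (forall x, K <= complex.Re (f x)) -> is_mean f c ->
  K <= complex.Re c.
Proof.
move=> fK Hc; apply/ler_addgt0Pl => e e0; have [s s0 Hs] := Hc e e0.
have H : K <= complex.Re (avg s f 0).
  have k0 : 0 < (size s)%:R :> R by rewrite ltr0n lt0n size_eq0.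
  have -> : complex.Re (avg s f 0) = (size s)%:R^-1 * \sum_(y <- s) complex.Re (f (0 + y)).
    rewrite /avg -(raddf_sum (@complex.Re R : Rcomplex R -> R)) /=.
    have -> : ((size s)%:R^-1 : cplx R) = ((size s)%:R^-1)%:C%C.
      by rewrite fmorphV rmorph_nat.
    by case: (\sum_(y <- s) _) => a b /=; rewrite mul0r subr0.
  rewrite -(ler_pM2l k0) mulrA divff ?gt_eqF // mul1r mulr_natl -iter_addr_0.
  by rewrite -(count_predT s) -big_const_seq; apply: ler_sum.
have := Re_le_normc (avg s f 0 - c); have := Hs 0.
rewrite (raddfB (@complex.Re R : Rcomplex R -> R)) /=.
by case: (ger0P (complex.Re (avg s f 0) - complex.Re c)); lra.
Qed.

(** By [meanP] the mean exists for a continuous function on a compact group;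
    the default value [0] covers the functions without a mean. *)
Definition mean f : cplx R := xget 0 (is_mean f).

Lemma is_meanE f c : is_mean f c -> mean f = c.
Proof. by move=> H; rewrite /mean; case: xgetP => [d _ Hd|/(_ c)//]; exact: is_mean_uniq Hd H. Qed.

End Mean.

Section UniformAveraging.
Variables (R : realType) (X : topologicalZmodType) (Xcompact : compact [set: X]).
Implicit Types (s t : seq X) (f g : X -> cplx R).

Lemma cont_addr (a : X) : continuous (fun x : X => x + a).
Proof.
move=> x; apply: (@continuous_comp _ _ _ (fun x : X => (x, a)) (fun z : X * X => z.1 + z.2)).
  by apply: cvg_pair => /=; [exact: cvg_id|exact: cvg_cst].
exact: add_continuous.
Qed.

Lemma cont_subl (a : X) : continuous (fun x : X => a - x).
Proof.
move=> x; apply: (@continuous_comp _ _ _ (fun x : X => (a, x)) (fun z : X * X => z.1 - z.2)).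
  by apply: cvg_pair => /=; [exact: cvg_cst|exact: cvg_id].
exact: sub_continuous.
Qed.

(** Total boundedness of a compact group. *)
Lemma finite_translates (V : set X) : nbhs (0 : X) V ->
  exists2 s, s != [::] & forall x, exists2 y, y \in s & V (x - y).
Proof.
move=> V0; apply: (compact_select Xcompact (L := [set s | s != [::]])
   (P := fun s x => exists2 y, y \in s & V (x - y))).
- by exists [:: 0].
- move=> g h g0 h0; exists (g ++ h); first by move: g0; case: (g).
  by move=> z [[y yg]|[y yh]] Vy; exists y => //; rewrite mem_cat ?yg ?yh ?orbT.
- move=> x; exists [:: x] => //.
  have H : nbhs x ((fun z => z - x) @^-1` V).
    by have := @cont_addr (- x) x; rewrite /continuous_at subrr => /(_ _ V0).
  by apply: filterS H => z Vz; exists x; rewrite ?inE.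
Qed.

(** The list [s] depends only on [V], [e] and [D], and not on [f]; this
    uniformity is what the interchange of means in [mean_fubini] rests on. *)
Lemma small_osc_avg (V : set X) (e D : R) : nbhs (0 : X) V -> 0 < e ->
  exists2 s, s != [::] & forall f,
    (forall x v, V v -> normc (f (x + v) - f x) <= e) ->
    (forall x y, normc (f x - f y) <= D) ->
    forall x y, normc (avg s f x - avg s f y) <= 2 * e.
Proof.
move=> V0 e0; have [s s0 Vs] := finite_translates V0.
have k0 : 0 < (size s)%:R :> R by rewrite ltr0n lt0n size_eq0.
have kV1 : (size s)%:R^-1 <= 1 :> R by rewrite invf_le1 // ler1n lt0n size_eq0.
have kV0 : 0 < (size s)%:R^-1 :> R by rewrite invr_gt0.
set q := 1 - (size s)%:R^-1 : R.
have q01 : 0 <= q < 1 by rewrite /q; lra.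
(* Each of the [n] averages over translates covering [X] contracts the part of
   the oscillation above [e] by the factor [q]. *)
have [n Hn] : exists n, q ^+ n * D <= e.
  have : (fun n => geometric D q n) @ \oo --> (0 : R).
    by apply: cvg_geometric; rewrite ger0_norm; lra.
  move=> /cvgrPdistC_lt/(_ e e0) [n _ Hn]; exists n.
  have H := Hn n (leqnn n); rewrite /= subr0 in H.
  by apply: le_trans (ltW H); rewrite mulrC ler_norm.
have [t t0 Ht] : exists2 t, t != [::] & forall f,
    (forall x v, V v -> normc (f (x + v) - f x) <= e) ->
    (forall x y, normc (f x - f y) <= D) ->
    forall x y, normc (avg t f x - avg t f y) <= e + q ^+ n * D.
  elim: n {Hn} => [|n [t t0 Ht]].
    exists [:: 0] => // f _ fD x y; rewrite /avg /= invr1 !mul1r !big_seq1 !addr0.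
    by rewrite ?mul1r (le_trans (fD _ _)) // lerDr ltW.
  exists [seq y + z | y <- s, z <- t]; first exact: allpairs_neq0.
  move=> f fV fD x y; rewrite -!avg_avg exprS -mulrA.
  apply: avg_contract Vs _ _ _ _ => //; last exact: Ht.
  move=> {x}y v Vv; rewrite /avg -mulrBr -sumrB.
  have -> : (size t)%:R^-1 * (\sum_(i <- t) (f (y + v + i) - f (y + i))) =
        avg t (fun y => f (y + v) - f y) y.
    by rewrite /avg; congr (_ * _); apply: eq_bigr => i _; rewrite addrAC.
  by apply: avg_le => // z; exact: fV.
exists t => // f fV fD x y; apply: le_trans (Ht f fV fD x y) _; lra.
Qed.

Lemma ccont_bounded f : continuous f -> exists2 K, 0 < K & forall x, normc (f x) <= K.
Proof.
move=> /cont_normc cf; have [K K0 H] := compact_bounded_fun Xcompact cf.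
by exists K => // x; apply: le_trans (H x); exact: ler_norm.
Qed.

Lemma equicont (Y : topologicalType) (Ycompact : compact [set: Y])
    (F : Y * X -> cplx R) (e : R) :
  continuous F -> 0 < e ->
  \forall v \near (0 : X), forall y x, normc (F (y, x + v) - F (y, x)) <= e.
Proof.
move=> cF e0.
have cG : continuous (fun z : X * (Y * X) => F (z.2.1, z.2.2 + z.1) - F z.2).
  move=> z; apply: (@continuousD _ _ _ (fun z : X * (Y * X) => F (z.2.1, z.2.2 + z.1))).
    apply: (@continuous_comp _ _ _ (fun z : X * (Y * X) => (z.2.1, z.2.2 + z.1)) F); last exact: cF.
    apply: cvg_pair => /=.
      by apply: (@continuous_comp _ _ _ snd fst); [exact: cvg_snd|exact: cvg_fst].
    apply: (@continuous_comp _ _ _ (fun z : X * (Y * X) => (z.2.2, z.1)) (fun z : X * X => z.1 + z.2)); last exact: add_continuous.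
    apply: cvg_pair => /=; last exact: cvg_fst.
    by apply: (@continuous_comp _ _ _ snd snd); exact: cvg_snd.
  apply: (@continuousN _ _ _ (fun z : X * (Y * X) => F z.2)).
  by apply: (@continuous_comp _ _ _ snd F); [exact: cvg_snd|exact: cF].
have YX : compact [set: Y * X].
  have -> : [set: Y * X] = [set: Y] `*` [set: X] by apply/seteqP; split.
  exact: compact_setX.
have := uniform_near_param YX 0 cG e0; apply: filterS => v H y x.
by have := H (y, x); rewrite /= addr0 subrr subr0.
Qed.

End UniformAveraging.

Section HaarMeanProperties.
Variables (R : realType) (X : topologicalZmodType) (Xcompact : compact [set: X]).
Implicit Types (s t : seq X) (f g : X -> cplx R).

Let mul2half (e : R) : 2 * (e / 2) = e. Proof. by field. Qed.

(** The averages with oscillation at most [1 / n] form a Cauchy sequence, since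
    any two averaging operators commute. *)
Lemma meanP f : continuous f -> is_mean f (mean f).
Proof.
move=> cf; suff [c Hc] : exists c, is_mean f c by rewrite (is_meanE Hc).
have [K K0 fK] := ccont_bounded Xcompact cf.
have fosc x y : normc (f x - f y) <= K + K.
  by apply: le_trans (normcD _ _) _; rewrite normcN lerD.
have cF : continuous (fun z : X * X => f z.2).
  by move=> z; apply: (@continuous_comp _ _ _ snd f); [exact: cvg_snd|exact: cf].
have small (e : R) : 0 < e -> exists2 s, s != [::] &
    forall x y, normc (avg s f x - avg s f y) <= e.
  move=> e0; have e2 : 0 < e / 2 by lra.
  have V0 := equicont Xcompact Xcompact cF e2.
  have [s s0 Hs] := small_osc_avg Xcompact (K + K) V0 e2.
  exists s => // x y; have := Hs f _ fosc x y; rewrite mul2half; apply.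
  by move=> z v Vv; have := Vv z z.
have /choice [s Hs] : forall n : nat, exists s : seq X, s != [::] /\
    forall x y, normc (avg s f x - avg s f y) <= (n.+1%:R)^-1.
  by move=> n; have [|s s0 Hs] := small (n.+1%:R)^-1; [by rewrite invr_gt0|exists s].
have inv_small (e : R) : 0 < e -> exists N, forall n, (N <= n)%N -> (n.+1%:R)^-1 <= e.
  move=> e0; exists (Num.truncn e^-1) => n Nn.
  rewrite -[e]invrK lef_pV2 ?posrE ?invr_gt0 // ltW //.
  by rewrite (lt_le_trans (truncnS_gt _)) ?ler_nat // ltW // invr_gt0.
have [c Hc] : exists c, forall e : R, 0 < e -> exists N, forall n, (N <= n)%N ->
    normc (avg (s n) f 0 - c) <= e.
  apply: cauchy_complex => e e0.
  have [N HN] := inv_small (e / 2) ltac:(lra); exists N => n Nn.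
  have [s0 H] := Hs n; have [t0 H'] := Hs N.
  apply: le_trans (avg_avg_close 0 0 s0 t0 H H') _.
  by apply: le_trans (lerD (HN n Nn) (HN N (leqnn N))) _; lra.
exists c => e e0.
have [N HN] := Hc (e / 2) ltac:(lra); have [M HM] := inv_small (e / 2) ltac:(lra).
have [s0 H] := Hs (maxn N M); exists (s (maxn N M)) => // x.
apply: le_trans (normcB _ (avg (s (maxn N M)) f 0) _) _.
apply: le_trans (lerD (le_trans (H x 0) (HM _ (leq_maxr N M))) (HN _ (leq_maxl N M))) _; lra.
Qed.

Lemma meanD f g : continuous f -> continuous g ->
  mean (fun x => f x + g x) = mean f + mean g.
Proof. by move=> cf cg; apply/is_meanE/is_meanD; exact: meanP. Qed.

Lemma meanZ (a : cplx R) f : continuous f -> mean (fun x => a * f x) = a * mean f.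
Proof. by move=> cf; apply/is_meanE/is_meanZ; exact: meanP. Qed.

Lemma mean_cst (c : cplx R) : mean (fun _ : X => c) = c.
Proof. exact/is_meanE/is_mean_cst. Qed.

Lemma mean_conj f : continuous f -> mean (fun x => conjc (f x) : cplx R) = conjc (mean f).
Proof. by move=> cf; apply/is_meanE/is_mean_conj; exact: meanP. Qed.

Lemma mean_shift a f : continuous f -> mean (fun x => f (x + a)) = mean f.
Proof. by move=> cf; apply/is_meanE/is_mean_shift; exact: meanP. Qed.

Lemma mean_reflect a f : continuous f -> mean (fun x => f (a - x)) = mean f.
Proof.
move=> cf; rewrite -(mean_shift a cf); apply/is_meanE.
have H : is_mean (fun x => f (x + a)) (mean f) by apply: is_mean_shift; exact: meanP.
rewrite (is_meanE H); have := is_mean_opp H.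
by congr is_mean; apply/funext => x; rewrite addrC.
Qed.

Lemma mean_le f (K : R) : continuous f -> (forall x, normc (f x) <= K) -> normc (mean f) <= K.
Proof. by move=> cf H; apply: is_mean_le H _; exact: meanP. Qed.

Lemma mean_dist f g (K : R) : continuous f -> continuous g ->
  (forall x, normc (f x - g x) <= K) -> normc (mean f - mean g) <= K.
Proof.
move=> cf cg H; have cN := ccontN cg.
suff -> : mean f - mean g = mean (fun x => f x + (- g x)).
  by apply: mean_le H; apply: ccontD; [exact: cf|exact: cN].
rewrite (meanD cf cN); congr (_ + _); rewrite -mulN1r -(meanZ _ cg).
by congr mean; apply/funext => x; rewrite mulN1r.
Qed.

Lemma mean_ge f (K : R) : continuous f -> (forall x, K <= complex.Re (f x)) ->
  K <= complex.Re (mean f).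
Proof. by move=> cf H; apply: is_mean_ge H _; exact: meanP. Qed.

Lemma mean_sum (I : Type) (s : seq I) (F : I -> X -> cplx R) :
  (forall i, continuous (F i)) ->
  mean (fun x => \sum_(i <- s) F i x) = \sum_(i <- s) mean (F i).
Proof.
move=> cF; have cs (t : seq I) := @ccont_sum _ _ _ t _ cF.
elim: s => [|i s IH].
  rewrite big_nil -[RHS](mean_cst 0); congr mean.
  by apply/funext => x; rewrite big_nil.
rewrite big_cons -IH -meanD //; congr mean.
by apply/funext => x; rewrite big_cons.
Qed.

Lemma cont_slice (Y : topologicalType) (F : Y * X -> cplx R) y :
  continuous F -> continuous (fun x => F (y, x)).
Proof.
move=> cF x; apply: (@continuous_comp _ _ _ (fun x : X => (y, x)) F); last exact: cF.
by apply: cvg_pair => /=; [exact: cvg_cst|exact: cvg_id].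
Qed.

Lemma cont_slicer (Y : topologicalType) (F : X * Y -> cplx R) y :
  continuous F -> continuous (fun x => F (x, y)).
Proof.
move=> cF x; apply: (@continuous_comp _ _ _ (fun x : X => (x, y)) F); last exact: cF.
by apply: cvg_pair => /=; [exact: cvg_id|exact: cvg_cst].
Qed.

Lemma mean_param_cont (Y : topologicalType) (F : Y * X -> cplx R) :
  continuous F -> continuous (fun y => mean (fun x => F (y, x))).
Proof.
move=> cF; apply/continuouscP => y e e0.
apply: filterS (uniform_near_param Xcompact y cF (_ : 0 < e / 2)); last lra.
move=> z H; apply: (@le_lt_trans _ _ (e / 2)); last lra.
by apply: mean_dist; [exact: cont_slice|exact: cont_slice|exact: H].
Qed.

(** One list of translates averages all the slices [F (x, _)] at once; taking
    the mean in [x] of these finite sums shows that the mean of the slices in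
    the other direction is approximated by averages, so that the iterated mean
    is a mean. *)
Lemma mean_fubini (F : X * X -> cplx R) : continuous F ->
  mean (fun x => mean (fun y => F (x, y))) = mean (fun y => mean (fun x => F (x, y))).
Proof.
move=> cF; have cm := mean_param_cont cF; apply/esym/is_meanE => e e0.
have e2 : 0 < e / 2 by lra.
have XX : compact [set: X * X].
  have -> : [set: X * X] = [set: X] `*` [set: X] by apply/seteqP; split.
  exact: compact_setX.
have [K K0 FK] := compact_bounded_fun XX (cont_normc cF).
have {}FK z : normc (F z) <= K by apply: le_trans (FK z); exact: ler_norm.
have V0 := equicont Xcompact Xcompact cF e2.
have [s s0 Hs] := small_osc_avg Xcompact (K + K) V0 e2.
have Hs' x y : normc (avg s (fun y => F (x, y)) y - mean (fun y => F (x, y))) <= e.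
  have /is_mean_avg : is_mean (fun y => F (x, y)) (mean (fun y => F (x, y))).
    by apply: meanP; exact: cont_slice.
  move=> /(_ s s0)/is_meanD/(_ (is_mean_cst X (- avg s (fun y => F (x, y)) y))) H.
  rewrite normc_distC; apply: is_mean_le H => z.
  have := Hs (fun y => F (x, y)) _ _ z y; rewrite mul2half; apply.
    by move=> {}z v /(_ x z).
  by move=> {}z w; apply: le_trans (normcD _ _) _; rewrite normcN lerD.
have cont_sum' y : continuous (fun x => \sum_(i <- s) F (x, y + i)).
  by apply: ccont_sum => i; exact: cont_slicer.
exists s => // y.
have -> : avg s (fun y => mean (fun x => F (x, y))) y = mean (fun x => avg s (fun y => F (x, y)) y).
  rewrite {1}/avg -mean_sum; last by move=> i; exact: cont_slicer.
  by rewrite -(meanZ _ (cont_sum' y)).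
apply: mean_dist; [|exact: cm|by move=> x; exact: Hs'].
by apply: ccontM; [exact: ccont_cst|exact: cont_sum'].
Qed.

(** The mean charges every neighbourhood of [0]: finitely many translates of
    [V] cover [X], and [k] is the inverse of their number. That [k] does not
    depend on [f] matters in [finite_fixed_point], where it is applied to all
    the powers of one function. *)
Lemma mean_lower (V : set X) : nbhs (0 : X) V -> exists2 k : R, 0 < k &
  forall f (d : R), continuous f -> (forall x, 0 <= complex.Re (f x)) ->
    (forall v, V v -> d <= complex.Re (f v)) -> k * d <= complex.Re (mean f).
Proof.
move=> V0; have [s s0 Vs] := finite_translates Xcompact V0.
have k0 : 0 < (size s)%:R :> R by rewrite ltr0n lt0n size_eq0.
exists (size s)%:R^-1; first by rewrite invr_gt0.
move=> f d cf f0 fV; have s0' : map -%R s != [::] by case: (s) s0.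
apply: is_mean_ge (is_mean_avg s0' (meanP cf)) => x.
have -> : complex.Re (avg (map -%R s) f x) = (size s)%:R^-1 * \sum_(y <- s) complex.Re (f (x - y)).
  rewrite /avg -(raddf_sum (@complex.Re R : Rcomplex R -> R)) /= size_map big_map.
  have -> : ((size s)%:R^-1 : cplx R) = ((size s)%:R^-1)%:C%C.
    by rewrite fmorphV rmorph_nat.
  by case: (\sum_(y <- s) _) => a b /=; rewrite mul0r subr0.
rewrite ler_pM2l ?invr_gt0 //; have [y ys Vy] := Vs x.
rewrite (big_rem y ys) /= (le_trans (fV _ Vy)) // lerDl.
by apply: sumr_ge0.
Qed.

End HaarMeanProperties.

Lemma conjc_opp (R : realType) (z : cplx R) : conjc (- z) = - conjc z :> cplx R.
Proof. exact: (rmorphN (@conjc R)). Qed.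

(** * The convolution algebra of continuous functions *)

Section ContinuousFunctions.
Variables (R : realType) (X : topologicalZmodType).

(** Continuous functions are bundled with their continuity proofs, so that the
    convolution algebra has total operations and a module structure. *)
Record cfun := Cfun { cfun_val :> X -> cplx R ; cfun_cont : continuous cfun_val }.

Lemma cfun_ext (f g : cfun) : (forall x, f x = g x) -> f = g.
Proof.
case: f => f cf; case: g => g cg /= /funext E; subst g; congr Cfun; exact: Prop_irrelevance.
Qed.

HB.instance Definition _ := gen_eqMixin cfun.
HB.instance Definition _ := gen_choiceMixin cfun.

Definition ccst (c : cplx R) := Cfun (@ccont_cst R X c).
Definition cadd (f g : cfun) := Cfun (ccontD (@cfun_cont f) (@cfun_cont g)).
Definition copp (f : cfun) := Cfun (ccontN (@cfun_cont f)).
Definition cmul (f g : cfun) := Cfun (ccontM (@cfun_cont f) (@cfun_cont g)).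
Definition cscale (a : R[i]) (f : cfun) := cmul (ccst a) f.
Definition cconj (f : cfun) := Cfun (ccont_conj (@cfun_cont f)).

Lemma caddA : associative cadd.
Proof. by move=> f g h; apply: cfun_ext => x; exact: addrA. Qed.
Lemma caddC : commutative cadd.
Proof. by move=> f g; apply: cfun_ext => x; exact: addrC. Qed.
Lemma cadd0 : left_id (ccst 0) cadd.
Proof. by move=> f; apply: cfun_ext => x; exact: add0r. Qed.
Lemma caddN : left_inverse (ccst 0) copp cadd.
Proof. by move=> f; apply: cfun_ext => x; exact: addNr. Qed.

HB.instance Definition _ := GRing.isZmodule.Build cfun caddA caddC cadd0 caddN.

Lemma cscaleA a b f : cscale a (cscale b f) = cscale (a * b) f.
Proof. by apply: cfun_ext => x; exact: mulrA. Qed.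
Lemma cscale1 : left_id 1 cscale.
Proof. by move=> f; apply: cfun_ext => x; exact: mul1r. Qed.
Lemma cscaleDr : right_distributive cscale +%R.
Proof. by move=> a f g; apply: cfun_ext => x; exact: mulrDr. Qed.
Lemma cscaleDl f : {morph cscale^~ f : a b / a + b}.
Proof. by move=> a b; apply: cfun_ext => x; exact: mulrDl. Qed.

HB.instance Definition _ := GRing.Zmodule_isLmodule.Build R[i] cfun
  cscaleA cscale1 cscaleDr cscaleDl.

Lemma cfunD (f g : cfun) x : (f + g) x = f x + g x. Proof. by []. Qed.
Lemma cfunN (f : cfun) x : (- f) x = - f x. Proof. by []. Qed.
Lemma cfunB (f g : cfun) x : (f - g) x = f x - g x. Proof. by []. Qed.
Lemma cfunZ (a : R[i]) (f : cfun) x : (a *: f) x = a * f x. Proof. by []. Qed.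
Lemma cfun0 x : (0 : cfun) x = 0. Proof. by []. Qed.

Lemma cfun_neq0 (f : cfun) : f != 0 -> exists x, f x != 0.
Proof.
move=> /eqP f0; apply: contrapT => H; apply: f0; apply: cfun_ext => x.
by apply: contrapT => fx; apply: H; exists x; apply/eqP.
Qed.

Lemma cont_shift (a : X) (f : cfun) : continuous (fun x => f (x + a)).
Proof.
move=> x; apply: (@continuous_comp _ _ _ (fun y => y + a) f); last exact: cfun_cont.
exact: cont_addr.
Qed.
Definition cshift a f := Cfun (@cont_shift a f).

Lemma cont_reflect (a : X) (f : cfun) : continuous (fun x => f (a - x)).
Proof.
move=> x; apply: (@continuous_comp _ _ _ (fun y => a - y) f); last exact: cfun_cont.
exact: cont_subl.
Qed.
Definition creflect a f := Cfun (@cont_reflect a f).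

(** The adjoint for convolution. *)
Definition star (f : cfun) := cconj (creflect 0 f).

Lemma starE f x : star f x = conjc (f (- x)).
Proof. by rewrite /star /= sub0r. Qed.

Lemma starK f : star (star f) = f.
Proof. by apply: cfun_ext => x; rewrite !starE opprK conjcK. Qed.

Lemma starD f g : star (f + g) = star f + star g.
Proof. by apply: cfun_ext => x; exact: conjc_add. Qed.

Lemma starN f : star (- f) = - star f.
Proof. by apply: cfun_ext => x; rewrite cfunN !starE cfunN conjc_opp. Qed.

Lemma starZ (a : R[i]) f : star (a *: f) = conjc a *: star f.
Proof. by apply: cfun_ext => x; exact: conjc_mul. Qed.

End ContinuousFunctions.

Section Convolution.
Variables (R : realType) (X : topologicalZmodType) (Xcompact : compact [set: X]).
Local Notation cfun := (cfun R X).
Implicit Types (f g h : cfun).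

Lemma cmeanD f g : mean (f + g) = mean f + mean g.
Proof. exact: (meanD Xcompact (@cfun_cont _ _ f) (@cfun_cont _ _ g)). Qed.

Lemma cmeanZ (a : R[i]) f : mean (a *: f) = a * mean f.
Proof. exact: (meanZ Xcompact a (@cfun_cont _ _ f)). Qed.

Lemma cmean_reflect a f : mean (creflect a f) = mean f.
Proof. exact: (mean_reflect Xcompact a (@cfun_cont _ _ f)). Qed.

Lemma cmean_conj f : mean (cconj f) = conjc (mean f).
Proof. exact: (mean_conj Xcompact (@cfun_cont _ _ f)). Qed.

Lemma cont_convint f g : continuous (fun z : X * X => f (z.1 - z.2) * g z.2).
Proof.
apply: ccontM => z.
  apply: (@continuous_comp _ _ _ (fun z : X * X => z.1 - z.2) f); last exact: cfun_cont.
  exact: sub_continuous.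
by apply: (@continuous_comp _ _ _ snd g); [exact: cvg_snd|exact: cfun_cont].
Qed.

Definition convol f g : cfun := Cfun (mean_param_cont Xcompact (@cont_convint f g)).

Lemma convolE f g x : convol f g x = mean (cmul (creflect x f) g).
Proof. by []. Qed.

Lemma convolC f g : convol f g = convol g f.
Proof.
apply: cfun_ext => x; rewrite !convolE -(cmean_reflect x).
by congr mean; apply/funext => y /=; rewrite subKr mulrC.
Qed.

Lemma convolA f g h : convol f (convol g h) = convol (convol f g) h.
Proof.
apply: cfun_ext => x; rewrite !convolE.
pose F (z : X * X) := f (x - z.1) * (g (z.1 - z.2) * h z.2).
have cF : continuous F.
  apply: ccontM; last exact: cont_convint.
  move=> z; apply: (@continuous_comp _ _ _ fst (creflect x f)); first exact: cvg_fst.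
  exact: cfun_cont.
transitivity (mean (fun u => mean (fun y => F (u, y)))).
  by congr mean; apply/funext => u; rewrite -[RHS]/(mean ((f (x - u) : R[i]) *: cmul (creflect u g) h)) cmeanZ.
rewrite mean_fubini //; congr mean; apply/funext => y.
transitivity (mean (h y *: cmul (creflect x f) (cshift (- y) g))).
  by congr mean; apply/funext => u; rewrite /F /=; ring.
rewrite cmeanZ mulrC; congr (_ * _).
rewrite -(mean_shift Xcompact y (@cfun_cont _ _ (cmul _ _))) -[RHS]/(convol f g (x - y)) convolE.
congr mean; apply/funext => u /=.
by rewrite addrK opprD addrCA addrA [x - y - u]addrAC [- u + x]addrC.
Qed.

Lemma convolDl f g h : convol (f + g) h = convol f h + convol g h.
Proof.
apply: cfun_ext => x; rewrite cfunD !convolE -cmeanD.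
by congr mean; apply/funext => y; exact: mulrDl.
Qed.

Lemma convolZl (a : R[i]) f g : convol (a *: f) g = a *: convol f g.
Proof.
apply: cfun_ext => x; rewrite cfunZ !convolE -cmeanZ.
by congr mean; apply/funext => y; rewrite /= mulrA.
Qed.

Lemma convolNl f g : convol (- f) g = - convol f g.
Proof. by rewrite -scaleN1r convolZl scaleN1r. Qed.

Lemma convolBl f g h : convol (f - g) h = convol f h - convol g h.
Proof. by rewrite convolDl convolNl. Qed.

Lemma convolDr f g h : convol h (f + g) = convol h f + convol h g.
Proof. by rewrite convolC convolDl !(convolC h). Qed.

Lemma convolBr f g h : convol h (f - g) = convol h f - convol h g.
Proof. by rewrite convolC convolBl !(convolC h). Qed.

Lemma convolZr (a : R[i]) f g : convol g (a *: f) = a *: convol g f.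
Proof. by rewrite convolC convolZl (convolC f). Qed.

Lemma convol0r f : convol f 0 = 0.
Proof. by have := convolBr f f f; rewrite !subrr. Qed.

Lemma convol_shift a f g : convol (cshift a f) g = cshift a (convol f g).
Proof.
apply: cfun_ext => x; rewrite -[RHS]/(convol f g (x + a)) !convolE.
by congr mean; apply/funext => y /=; rewrite addrAC.
Qed.

Lemma convol_star f g : star (convol f g) = convol (star f) (star g).
Proof.
apply: cfun_ext => x; rewrite starE !convolE -cmean_conj -(cmean_reflect 0).
congr mean; apply/funext => y /=.
by rewrite conjc_mul !sub0r opprB opprK addrC.
Qed.

Lemma convol_le f g x (A B : R) : 
  (forall x, normc (f x) <= A) -> (forall x, normc (g x) <= B) -> normc (convol f g x) <= A * B.
Proof.
move=> fA gB; rewrite convolE; apply: (mean_le Xcompact); first exact: cfun_cont.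
by move=> y; rewrite normcM ler_pM ?normc_ge0 //=.
Qed.

(** The square of the Hilbert norm for the Haar mean. *)
Definition nrm2 f : R := complex.Re (mean (cmul f (cconj f))).

Lemma nrm2E f : mean (cmul f (cconj f)) = (nrm2 f)%:C%C.
Proof.
have := cmean_conj (cmul f (cconj f)).
have -> : cconj (cmul f (cconj f)) = cmul f (cconj f).
  by apply: cfun_ext => x; rewrite /= mulc_conj conjc_real.
rewrite /nrm2; case: (mean _) => a b [] /eqP.
by rewrite -addr_eq0 -mulr2n mulrn_eq0 /= => /eqP ->.
Qed.

Lemma nrm2_ge0 f : 0 <= nrm2 f.
Proof.
apply: (mean_ge Xcompact); first exact: cfun_cont.
by move=> x; rewrite /= mulc_conj /= sqr_ge0.
Qed.

Lemma nrm2_reflect x f : nrm2 (creflect x f) = nrm2 f.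
Proof. by rewrite /nrm2 -(cmean_reflect x (cmul f _)). Qed.

Lemma nrm2_conj f : nrm2 (cconj f) = nrm2 f.
Proof.
rewrite /nrm2; congr (complex.Re (mean _)); apply/funext => x /=.
by rewrite conjcK mulrC.
Qed.

(** The Haar mean is faithful. *)
Lemma nrm2_gt0 f : f != 0 -> 0 < nrm2 f.
Proof.
move=> /cfun_neq0[x fx0].
have n0 := normc_gt0 fx0; pose n := normc (f x).
rewrite -(nrm2_reflect x).
have V0 : nbhs (0 : X) [set v | n / 2 < normc (creflect x f v)].
  have /continuouscP/(_ 0 (n / 2) ltac:(rewrite /n; lra)) := @cfun_cont _ _ (creflect x f).
  apply: filterS => v /=; rewrite subr0 normc_distC => H.
  by have := normcB (f x) (f (x - v)) 0; rewrite !subr0 /n; rewrite /n in H; lra.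
have [k k0 Hk] := @mean_lower R X Xcompact _ V0.
apply: (@lt_le_trans _ _ (k * (n / 2) ^+ 2)).
  by rewrite mulr_gt0 // exprn_gt0 // divr_gt0.
apply: Hk; first exact: cfun_cont.
  by move=> y; rewrite /= mulc_conj /= sqr_ge0.
move=> v Vv; rewrite /= mulc_conj /= lerXn2r ?nnegrE ?normc_ge0 ?ltW //.
by rewrite /n; lra.
Qed.

(** The usual argument: the norm of [B f - z g] is nonnegative, for [B] the
    square norm of [g] and [z] the inner product. *)
Lemma cauchy_schwarz f g : normc (mean (cmul f g)) ^+ 2 <= nrm2 f * nrm2 g.
Proof.
rewrite -(nrm2_conj g) -[g in cmul f g](_ : cconj (cconj g) = g); last first.
  by apply: cfun_ext => x /=; rewrite conjcK.
move: (cconj g) => {}g.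
set z := mean _; pose B := nrm2 g.
have [g0|g0] := eqVneq g 0.
  have -> : z = 0 by rewrite /z g0 -(mean_cst X 0); congr mean; apply/funext => x; rewrite -[LHS]/(f x * conjc 0) conjc0 mulr0.
  by rewrite normc0 expr0n /= mulr_ge0 ?nrm2_ge0.
have B0 : 0 < B by exact: nrm2_gt0.
pose h := (B%:C%C : R[i]) *: f - (z : R[i]) *: g.
have hE : cmul h (cconj h) =
    ((B ^+ 2)%:C%C : R[i]) *: cmul f (cconj f) + ((- (B%:C%C * conjc z)) *: cmul f (cconj g) +
    ((- (B%:C%C * z)) *: cconj (cmul f (cconj g)) + ((normc z ^+ 2)%:C%C : R[i]) *: cmul g (cconj g))).
  apply: cfun_ext => x; rewrite !cfunD !cfunZ /= -mulc_conj.
  rewrite !(conjc_add, conjc_mul, conjc_opp) conjcK conjc_real rmorphXn /=; ring.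
have := nrm2_ge0 h; rewrite /nrm2 hE !cmeanD !cmeanZ cmean_conj !nrm2E -/z -/B.
have -> : (B ^+ 2)%:C%C * (nrm2 f)%:C%C +
   (- (B%:C%C * z^*%C) * z + (- (B%:C%C * z) * z^*%C + (normc z ^+ 2)%:C%C * B%:C%C)) =
   (B * (nrm2 f * B - normc z ^+ 2))%:C%C :> R[i].
  transitivity ((B ^+ 2)%:C%C * (nrm2 f)%:C%C - B%:C%C * (z * conjc z) : R[i]).
    rewrite -mulc_conj; ring.
  rewrite mulc_conj -!rmorphM -rmorphB; congr (_%:C%C); ring.
by rewrite /= pmulr_rge0 // subr_ge0.
Qed.

Lemma convol_bound f g x : normc (convol f g x) ^+ 2 <= nrm2 f * nrm2 g.
Proof. by rewrite convolE (le_trans (cauchy_schwarz _ _)) // nrm2_reflect. Qed.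

Lemma convol_self0 f : star f = f -> convol f f 0 = (nrm2 f)%:C%C.
Proof.
move=> sf; rewrite convolE -nrm2E; congr mean; apply/funext => y /=.
by rewrite sub0r mulrC -{2}sf starE opprK.
Qed.

Lemma convol_self_le f x : normc (convol f f x) <= nrm2 f.
Proof.
have := convol_bound f f x; rewrite -expr2 ler_pXn2r ?nnegrE ?normc_ge0 ?nrm2_ge0 //.
Qed.

End Convolution.

(** * Power iteration and idempotents *)

Section Limits.
Variable R : realType.

Definition rcvg (a : nat -> R) (l : R) := forall e : R, 0 < e ->
  exists N, forall n, (N <= n)%N -> `|a n - l| <= e.

(** The supremum of the sequence is kept because it also serves as an upper
    bound. *)
Lemma mono_rcvg (a : nat -> R) (K : R) : (forall n, a n <= a n.+1) -> (forall n, a n <= K) ->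
  exists2 l, rcvg a l & forall n, a n <= l.
Proof.
move=> amono aK.
have ndec : nondecreasing_seq a by apply/nondecreasing_seqP.
have ub : has_ubound (range a) by exists K => _ [n _ <-].
have cv := nondecreasing_is_cvgn ndec ub.
exists (limn a); last by move=> n; exact: nondecreasing_cvgn_le.
move=> e e0; have /cvgrPdistC_lt/(_ e e0) [N _ HN] := cv.
by exists N => n Nn; apply: ltW; exact: HN.
Qed.

Variables (X : topologicalZmodType) (Xcompact : compact [set: X]).
Local Notation cfun := (cfun R X).
Local Notation convol := (convol Xcompact).
Implicit Types (f g h : cfun) (u v : nat -> cfun).

Definition ucvg u f := forall e : R, 0 < e ->
  exists N, forall n, (N <= n)%N -> forall x, normc (u n x - f x) <= e.

Lemma cfun_bounded f : exists2 K, 0 < K & forall x, normc (f x) <= K.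
Proof. exact: (ccont_bounded Xcompact (@cfun_cont _ _ f)). Qed.

Lemma ucvg_cauchy u : (forall e : R, 0 < e ->
    exists N, forall n, (N <= n)%N -> forall x, normc (u n x - u N x) <= e) ->
  exists f, ucvg u f.
Proof.
move=> H.
have /choice [f Hf] : forall x, exists l, forall e : R, 0 < e ->
    exists N, forall n, (N <= n)%N -> normc (u n x - l) <= e.
  move=> x; apply: cauchy_complex => e e0; have [N HN] := H e e0.
  by exists N => n Nn; exact: HN.
have Hu (e : R) : 0 < e -> exists N, forall n, (N <= n)%N -> forall x, normc (u n x - f x) <= e.
  move=> e0; have [N HN] := H (e / 4%:R) ltac:(lra); exists N => n Nn x.
  have [M HM] := Hf x (e / 4%:R) ltac:(lra).
  have := HM _ (leq_maxr N M); have := HN _ (leq_maxl N M) x; have := HN n Nn x.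
  set m := maxn N M.
  have := normcB (u n x) (u m x) (f x).
  have := normcB (u n x) (u N x) (u m x).
  by rewrite (normc_distC (u N x)); lra.
have cf : continuous f.
  apply: ccont_unif => e e0; have [N HN] := Hu e e0; exists (u N); first exact: cfun_cont.
  by move=> x; rewrite normc_distC; exact: HN.
by exists (Cfun cf).
Qed.

Lemma ucvg_uniq u f g : ucvg u f -> ucvg u g -> f = g.
Proof.
move=> uf ug; apply: cfun_ext => x; apply/eqP; rewrite -subr_eq0.
apply/eqP/normc_le_small => e e0.
have [N HN] := uf (e / 2) ltac:(lra); have [M HM] := ug (e / 2) ltac:(lra).
have := HM _ (leq_maxr N M) x; have := HN _ (leq_maxl N M) x.
by have := normcB (f x) (u (maxn N M) x) (g x); rewrite (normc_distC (f x) (u _ _)); lra.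
Qed.

Lemma ucvg_cst f : ucvg (fun=> f) f.
Proof. by move=> e e0; exists 0%N => n _ x; rewrite subrr normc0 ltW. Qed.

Lemma ucvg_close u v f : ucvg u f -> (forall e : R, 0 < e ->
  exists N, forall n, (N <= n)%N -> forall x, normc (v n x - u n x) <= e) -> ucvg v f.
Proof.
move=> uf vu e e0.
have [N HN] := uf (e / 2) ltac:(lra); have [M HM] := vu (e / 2) ltac:(lra).
exists (maxn N M) => n; rewrite geq_max => /andP[Nn Mn] x.
by have := normcB (v n x) (u n x) (f x); have := HN n Nn x; have := HM n Mn x; lra.
Qed.

Lemma ucvg_comp u f (phi : nat -> nat) :
  (forall n, (n <= phi n)%N) -> ucvg u f -> ucvg (u \o phi) f.
Proof.
move=> Hphi uf e e0; have [N HN] := uf e e0; exists N => n Nn.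
exact/HN/(leq_trans Nn).
Qed.

Lemma ucvg_star u f : ucvg u f -> ucvg (fun n => star (u n)) (star f).
Proof.
move=> uf e e0; have [N HN] := uf e e0; exists N => n Nn x.
by rewrite !starE -(rmorphB (@conjc R)) normc_conj; exact: HN.
Qed.

Lemma ucvg_scale (a : nat -> R) l u f : rcvg a l -> ucvg u f ->
  ucvg (fun n => ((a n)%:C%C : R[i]) *: u n) ((l%:C%C : R[i]) *: f).
Proof.
move=> al uf e e0; have [K K0 fK] := cfun_bounded f.
have l0 : 0 <= `|l| := normr_ge0 l.
have Kl : 0 < K + `|l| + 1 by lra.
pose d := Num.min 1 (e / (K + `|l| + 1)).
have d0 : 0 < d by rewrite /d lt_min ltr01 divr_gt0.
have d1 : d <= 1 by rewrite /d ge_min lexx.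
have de : d * (K + `|l| + 1) <= e by rewrite -ler_pdivlMr // /d ge_min lexx orbT.
have [N HN] := al _ d0; have [M HM] := uf _ d0.
exists (maxn N M) => n; rewrite geq_max => /andP[Nn Mn] x.
rewrite !cfunZ.
have -> : (a n)%:C%C * u n x - l%:C%C * f x =
   (a n - l)%:C%C * u n x + l%:C%C * (u n x - f x) :> R[i] by rewrite rmorphB; ring.
apply: le_trans (normcD _ _) _; rewrite !normcM !normc_real.
have H1 := HN n Nn; have H2 := HM n Mn x.
have H3 : normc (u n x) <= K + 1.
  by have := normcB (u n x) (f x) 0; have := fK x; rewrite !subr0; lra.
have := ler_pM (normr_ge0 _) (normc_ge0 _) H1 H3.
have := ler_wpM2l l0 H2; lra.
Qed.

Lemma ucvg_conv u v f g : ucvg u f -> ucvg v g ->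
  ucvg (fun n => convol (u n) (v n)) (convol f g).
Proof.
move=> uf vg e e0; have [K K0 fK] := cfun_bounded f; have [L L0 gL] := cfun_bounded g.
have KL : 0 < K + L + 1 by lra.
pose d := Num.min 1 (e / (K + L + 1)).
have d0 : 0 < d by rewrite /d lt_min ltr01 divr_gt0.
have d1 : d <= 1 by rewrite /d ge_min lexx.
have de : d * (K + L + 1) <= e by rewrite -ler_pdivlMr // /d ge_min lexx orbT.
have [N HN] := uf _ d0; have [M HM] := vg _ d0.
exists (maxn N M) => n; rewrite geq_max => /andP[Nn Mn] x.
have -> : convol (u n) (v n) x - convol f g x = convol (u n - f) (v n) x + convol f (v n - g) x.
  by rewrite convolBl convolBr !cfunB addrA subrK.
apply: le_trans (normcD _ _) _.
have H1 := @convol_le _ _ Xcompact (u n - f) (v n) x d (L + 1) (HN n Nn).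
have H2 := @convol_le _ _ Xcompact f (v n - g) x K d fK (HM n Mn).
have {}H1 : normc (convol (u n - f) (v n) x) <= d * (L + 1).
  apply: H1 => y; have := HM n Mn y; have := gL y; have := normcB (v n y) (g y) 0.
  by rewrite !subr0; lra.
lra.
Qed.

End Limits.

Section PowerIteration.
Variables (R : realType) (X : topologicalZmodType) (Xcompact : compact [set: X]).
Local Notation cfun := (cfun R X).
Local Notation convol := (convol Xcompact).
Variables (w : cfun) (sw : star w = w) (w0 : w != 0).

Let W n := iter n (convol w) w.
Let p n := convol (W n) (W n).
Let a n := nrm2 (W n).
Let c n m := a (n + m).+1 / (a n * a m).
Let P n : cfun := ((a n)^-1%:C%C : R[i]) *: p n.

Let W_add n m : convol (W n) (W m) = W (n + m).+1.
Proof.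
elim: n => [|n IH] //; rewrite addSn [W n.+1]/(convol w (W n)) -convolA IH.
by [].
Qed.

Let W_star n : star (W n) = W n.
Proof. by elim: n => //= n IH; rewrite convol_star sw IH. Qed.

Let pE n : p n = W (n + n).+1. Proof. exact: W_add. Qed.

Let p_add n m : convol (p n) (p m) = p (n + m).+1.
Proof. by rewrite !pE W_add; congr W; lia. Qed.

Let p_at0 n : p n 0 = (a n)%:C%C.
Proof. exact: convol_self0. Qed.

Let a_ge0 n : 0 <= a n. Proof. exact: nrm2_ge0. Qed.

(** The inner product of [W n] and [W (n + 2)] is [a (n + 1)]. *)
Let a_logconvex n : a n.+1 ^+ 2 <= a n * a n.+2.
Proof.
have := convol_bound Xcompact (W n) (W n.+2) 0.
rewrite W_add (_ : (n + n.+2).+1 = (n.+1 + n.+1).+1); last lia.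
by rewrite -pE p_at0 normc_real ger0_norm.
Qed.

Let a_gt0 n : 0 < a n.
Proof.
suff: 0 < a n /\ 0 < a n.+1 by case.
elim: n => [|n [IH1 IH2]].
  have a0 : 0 < a 0%N by exact: (nrm2_gt0 Xcompact).
  split=> //; apply: (nrm2_gt0 Xcompact); apply/eqP => W10.
  have := p_at0 0%N; rewrite pE addn0 W10 cfun0 => /(congr1 (@complex.Re R)) /= H.
  by rewrite -H ltxx in a0.
split; first exact: IH2.
have := a_logconvex n; have : 0 < a n.+1 ^+ 2 by rewrite exprn_gt0.
by move=> /lt_le_trans H/H; rewrite pmulr_rgt0.
Qed.

Let a_neq0 n : a n != 0. Proof. by rewrite gt_eqF. Qed.

(** In spectral terms, the trace of a product of commuting positive operators
    is at most the product of their traces. *)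
Let a_sub n m : a (n + m).+1 <= a n * a m.
Proof.
have pa k x : normc (p k x) <= a k by exact: (convol_self_le Xcompact).
have := @convol_le _ _ Xcompact (p n) (p m) 0 (a n) (a m) (pa n) (pa m).
by rewrite p_add p_at0 normc_real ger0_norm.
Qed.

Let r n := a n.+1 / a n.

Let r_mono n m : (n <= m)%N -> r n <= r m.
Proof.
apply: (@homo_leq _ r <=%R) => // [y x z|{}n]; first exact: le_trans.
by rewrite /r ler_pdivlMr // mulrAC ler_pdivrMr // -expr2 mulrC a_logconvex.
Qed.

Let c_sym n m : c n m = c m n.
Proof. by rewrite /c addnC [a n * _]mulrC. Qed.

Let c_mono1 n m k : (n <= k)%N -> c n m <= c k m.
Proof.
apply: (@homo_leq _ (c ^~ m) <=%R) => // [y x z|{k}n]; first exact: le_trans.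
have H := r_mono (_ : n <= (n + m).+1)%N.
have {H} := H ltac:(lia); rewrite /r /c addSn.
rewrite ler_pdivrMr // mulrAC ler_pdivlMr // => H.
rewrite ler_pdivrMr ?mulr_gt0 // mulrAC ler_pdivlMr ?mulr_gt0 //.
rewrite !mulrA (ler_pM2r (a_gt0 m)) [leLHS]mulrC; exact: H.
Qed.

Let c_mono n m k l : (n <= k)%N -> (m <= l)%N -> c n m <= c k l.
Proof.
move=> nk ml; apply: le_trans (c_mono1 m nk) _.
by rewrite c_sym [leRHS]c_sym c_mono1.
Qed.

Let c_gt0 n m : 0 < c n m.
Proof. by rewrite divr_gt0 // mulr_gt0. Qed.

Let c_le1 n m : c n m <= 1.
Proof. by rewrite ler_pdivrMr ?mul1r ?mulr_gt0. Qed.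

Let P_star n : star (P n) = P n.
Proof. by rewrite starZ conjc_real convol_star W_star. Qed.

Let P_add n m : convol (P n) (P m) = ((c n m)%:C%C : R[i]) *: P (n + m).+1.
Proof.
rewrite convolZl convolZr p_add !scalerA -!rmorphM; congr (_%:C%C *: _).
by rewrite /c; field; rewrite !a_neq0.
Qed.

Let P_at0 n : P n 0 = 1.
Proof. by rewrite cfunZ p_at0 -rmorphM mulVf. Qed.

Let P_add0 n m : convol (P n) (P m) 0 = (c n m)%:C%C.
Proof. by rewrite P_add cfunZ P_at0 mulr1. Qed.

Let nrm2_P n : nrm2 (P n) = c n n.
Proof. by apply: (@complexI R); rewrite -(convol_self0 Xcompact (P_star n)) P_add0. Qed.

Let nrm2_PB n m : nrm2 (P n - P m) = c n n - c n m *+ 2 + c m m.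
Proof.
apply: (@complexI R); rewrite -(convol_self0 Xcompact); last by rewrite starD starN !P_star.
rewrite convolBl !convolBr !cfunB !P_add0 (c_sym m n) rmorphD rmorphB rmorphMn /=; ring.
Qed.

Let nrm2_PD n m : nrm2 (P n + P m) = c n n + c n m *+ 2 + c m m.
Proof.
apply: (@complexI R); rewrite -(convol_self0 Xcompact); last by rewrite starD !P_star.
rewrite convolDl !convolDr !cfunD !P_add0 (c_sym m n) !rmorphD /=; ring.
Qed.

(** With [W n] the convolution power of [w] of exponent [n + 1], [a n] its
    square norm and [p n = W n * W n], whose value at [0] is [a n], the
    functions [P n = p n / a n] have inner products
    [c n m = a (n + m + 1) / (a n * a m)]. These are nondecreasing in both
    indices because [a] is log-convex, and at most [1] because [|p n| <= a n];
    hence they converge to a positive number [L], and the sequence [P n] is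
    Cauchy in mean square. Convolution turns this into the uniform convergence
    of [P n * P n], whose limit is the idempotent up to the factor [L ^ 2]. *)
Lemma power_idempotent : exists (E : cfun) (rho : R),
  [/\ star E = E, E != 0, convol E E = E, 0 < rho &
      convol (convol w w) E = (rho%:C%C : R[i]) *: E].
Proof.
have [L cL cleL] := @mono_rcvg _ (fun n => c n n) 1
  (fun n => c_mono (leqnSn n) (leqnSn n)) (fun n => c_le1 n n).
have L0 : 0 < L by apply: lt_le_trans (cleL 0%N).
have r_le n : r n <= a 0%N.
  by rewrite /r ler_pdivrMr // mulrC -[n in n.+1]addn0 a_sub.
have [rho rrho rle] := @mono_rcvg _ r (a 0%N) (fun n => r_mono (leqnSn n)) r_le.
(* The constant 4 bounds the square norms of both [P n] and [P n + P m]. *)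
have P_close (e : R) : 0 < e -> exists N, forall n m, (N <= n)%N -> (N <= m)%N ->
    forall g, nrm2 g <= 4 -> forall x, normc (convol (P n - P m) g x) <= e.
  move=> e0; have [|N HN] := cL (e ^+ 2 / 8); first by rewrite divr_gt0 ?exprn_gt0.
  exists N => n m Nn Nm g g4 x.
  rewrite -(@ler_pXn2r _ 2) ?nnegrE ?normc_ge0 ?(ltW e0) //.
  apply: le_trans (convol_bound _ _ _ _) _.
  have H : nrm2 (P n - P m) <= e ^+ 2 / 4.
    rewrite nrm2_PB mulr2n; have := HN N (leqnn N); have := cleL n; have := cleL m.
    by have := c_mono Nn Nm; rewrite ler_norml => ? ? ? /andP[? ?]; lra.
  apply: le_trans (ler_pM (nrm2_ge0 Xcompact _) (nrm2_ge0 Xcompact _) H g4) _.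
  lra.
pose Q n := convol (P n) (P n).
have [F QF] : exists F, ucvg Q F.
  apply: ucvg_cauchy => e e0; have [N HN] := P_close e e0; exists N => n Nn x.
  have -> : Q n x - Q N x = convol (P n - P N) (P n + P N) x.
    rewrite convolBl !convolDr !cfunB !cfunD (convolC _ (P N) (P n)) /Q.
    by rewrite opprD addrA addrK.
  apply: HN => //; rewrite nrm2_PD mulr2n.
  by have := c_le1 n n; have := c_le1 N N; have := c_le1 n N; lra.
have Q_at0 n : Q n 0 = (c n n)%:C%C by exact: P_add0.
have F0 : F != 0.
  apply/eqP => F0; have [|N HN] := QF (c 0%N 0%N / 2); first by rewrite divr_gt0.
  have := HN N (leqnn N) 0; rewrite F0 cfun0 subr0 Q_at0 normc_real.
  have := c_mono (leq0n N) (leq0n N); have := c_gt0 0%N 0%N.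
  by rewrite ger0_norm ?(ltW (c_gt0 _ _)) //; lra.
have sF : star F = F.
  apply: ucvg_uniq (ucvg_star QF) _.
  have -> : (fun n => star (Q n)) = Q by apply/funext => n; rewrite convol_star P_star.
  by [].
have FF : convol F F = (L%:C%C : R[i]) *: ((L%:C%C : R[i]) *: F).
  apply: (ucvg_uniq (ucvg_conv Xcompact QF QF)).
  have -> : (fun n => convol (Q n) (Q n)) = (fun n => ((c n n)%:C%C : R[i]) *:
       (((c n n)%:C%C : R[i]) *: (Q \o (fun n => (n + n).+1)) n)).
    by apply/funext => n; rewrite /Q P_add convolZl convolZr.
  apply: (ucvg_scale Xcompact cL); apply: (ucvg_scale Xcompact cL); apply: ucvg_comp => // n; lia.
have wF : convol (convol w w) F = (rho%:C%C : R[i]) *: F.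
  apply: (ucvg_uniq (ucvg_conv Xcompact (ucvg_cst (convol w w)) QF)).
  have -> : (fun n => convol (convol w w) (Q n)) =
      fun n => ((r n)%:C%C : R[i]) *: convol (P n.+1) (P n).
    apply/funext => n; rewrite /Q convolA -convolZl; congr (convol _ _).
    rewrite /P convolZr -[convol w w]/(p 0%N) p_add add0n !scalerA -!rmorphM.
    by congr (_%:C%C *: _); rewrite /r; field; rewrite !a_neq0.
  apply: (ucvg_scale Xcompact rrho); apply: ucvg_close QF _ => e e0.
  have [N HN] := P_close e e0; exists N => n Nn x.
  rewrite /Q -cfunB -convolBl; apply: HN => //; first exact: leqW.
  by rewrite nrm2_P (le_trans (c_le1 _ _)) // ler1n.
exists ((((L ^+ 2)^-1)%:C%C : R[i]) *: F), rho; split.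
- by rewrite starZ conjc_real sF.
- rewrite scaler_eq0 negb_or F0 andbT (fmorph_eq0 (real_complex R)).
  by rewrite invr_eq0 expf_eq0 /= gt_eqF.
- rewrite convolZl convolZr FF !scalerA -!rmorphM; congr (_%:C%C *: _).
  by field; rewrite gt_eqF.
- by apply: lt_le_trans (rle 0%N); rewrite divr_gt0.
- by rewrite convolZr wF !scalerA mulrC.
Qed.

End PowerIteration.

Definition is_char (R : realType) (X : topologicalZmodType) (chi : X -> cplx R) : Prop :=
  [/\ continuous chi, forall x y, chi (x + y) = chi x * chi y & forall x, normc (chi x) = 1].

(** * Characters separate points *)

Section Characters.
Variables (R : realType) (X : topologicalZmodType) (Xcompact : compact [set: X]).
Local Notation cfun := (cfun R X).
Local Notation convol := (convol Xcompact).
Implicit Types (E Q f g h w : cfun).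

(** A nonzero self-adjoint idempotent is the kernel of an orthogonal projection
    onto a translation-invariant space of finite dimension, and its value at
    [0], which is also its square norm, is this dimension. *)
Definition idem_fun E := [/\ star E = E, convol E E = E & E != 0].

Lemma idem_at0 E : idem_fun E -> E 0 = (nrm2 E)%:C%C.
Proof. by move=> [sE EE _]; rewrite -{1}EE convol_self0. Qed.

Lemma idem_le E x : idem_fun E -> normc (E x) <= nrm2 E.
Proof. by move=> [sE EE _]; rewrite -{1}EE convol_self_le. Qed.

(** The square norm of [E] is [E 0], which bounds [|E|]; so it is at most its
    own square. *)
Lemma idem_trace_ge1 E : idem_fun E -> 1 <= nrm2 E.
Proof.
move=> iE; have [sE EE E0] := iE; have n0 := nrm2_gt0 Xcompact E0.
have H : nrm2 E <= nrm2 E * nrm2 E.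
  apply: le_trans (ler_norm _) _; apply: le_trans (Re_le_normc _) _.
  apply: (mean_le Xcompact); first exact: cfun_cont.
  by move=> x; rewrite /= normcM normc_conj ler_pM ?normc_ge0 ?idem_le.
by rewrite -(ler_pM2l n0) mulr1.
Qed.

(** Minimal for the order of projections: [Q'] lies below [Q] when [Q] acts on
    [Q'] as the identity. *)
Definition minimal_idem Q := idem_fun Q /\ forall Q', idem_fun Q' -> convol Q Q' = Q' -> Q' = Q.

(** If [Q'] lies strictly below [E], then [E - Q'] is an idempotent, and the
    rank drops by at least [1]. *)
Lemma minimal_idem_exists E : idem_fun E -> exists2 Q, minimal_idem Q & convol E Q = Q.
Proof.
move=> iE0; have := truncnS_gt (nrm2 E); move: (Num.truncn _) iE0 => n.
elim: n E => [|n IH] E iE En; have E1 := idem_trace_ge1 iE; first lra.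
have [[Q' [iQ' EQ' Q'E]]|H] := pselect (exists Q', [/\ idem_fun Q', convol E Q' = Q' & Q' <> E]); last first.
  exists E; last by case: iE.
  split=> // Q' iQ' EQ'; apply: contrapT => Q'E; apply: H; by exists Q'.
have [sE EE E0] := iE; have [sQ QQ Q0] := iQ'.
have iD : idem_fun (E - Q').
  split; first by rewrite starD starN sE sQ.
    by rewrite convolBl !convolBr EE EQ' QQ convolC EQ' subrr subr0.
  by rewrite subr_eq0; apply/eqP => /esym.
have D1 := idem_trace_ge1 iD.
have trE : nrm2 E = nrm2 Q' + nrm2 (E - Q').
  apply: (@complexI R); rewrite rmorphD /= -!idem_at0 // cfunB; ring.
have [|Q mQ Q'Q] := IH Q' iQ'.
  by rewrite -(ltrD2r 1) natr1; apply: le_lt_trans En; rewrite trE lerD2l.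
by exists Q => //; rewrite -Q'Q convolA EQ'.
Qed.

(** By [power_idempotent] and minimality, [v * v] is a multiple of [Q] for
    every self-adjoint [v] in the ideal of [Q]; this applies to [w] and to
    [w - Q], and [2 w = w * w + Q - (w - Q) * (w - Q)]. *)
Lemma minimal_idem_sa Q w : minimal_idem Q -> star w = w -> convol Q w = w ->
  exists l : R[i], w = l *: Q.
Proof.
move=> [iQ minQ] sw Qw; have [sQ QQ Q0] := iQ.
have sq v : star v = v -> convol Q v = v -> exists l : R[i], convol v v = l *: Q.
  move=> sv Qv; have [v0|v0] := eqVneq v 0.
    by exists 0; rewrite {1}v0 convolC convol0r scale0r.
  have [E [rho [sE E0 EE rho0 vE]]] := power_idempotent Xcompact sv v0.
  have rho_neq0 : (rho%:C%C : R[i]) != 0 by rewrite (fmorph_eq0 (real_complex R)) gt_eqF.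
  have QE : convol Q E = E.
    apply: (scalerI rho_neq0); rewrite -convolZr -vE !convolA Qv.
    by [].
  have EQ := minQ E (And3 sE EE E0) QE; rewrite EQ in vE.
  by exists rho%:C%C; rewrite -vE -convolA (convolC _ v Q) Qv.
have [l wl] := sq w sw Qw.
have [|| m wm] := sq (w - Q); first by rewrite starD starN sw sQ.
  by rewrite convolBr Qw QQ.
have H : (2 : R[i]) *: w = (l + 1 - m) *: Q.
  rewrite scaler_nat mulr2n scalerBl scalerDl scale1r -wl -wm.
  rewrite convolBl !convolBr (convolC _ w Q) Qw QQ.
  by apply: cfun_ext => x; rewrite !(cfunD, cfunN); ring.
exists (2^-1 * (l + 1 - m)); rewrite -scalerA -H scalerA mulVf ?scale1r //.
Qed.

(** Decompose [f] into its self-adjoint and anti-self-adjoint parts. *)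
Lemma minimal_idem_line Q f : minimal_idem Q -> convol Q f = f -> exists l : R[i], f = l *: Q.
Proof.
move=> mQ Qf; have [[sQ QQ Q0] _] := mQ.
have Qsf : convol Q (star f) = star f by rewrite -{1}sQ -convol_star Qf.
have [||u fu] := @minimal_idem_sa Q (f + star f) mQ.
- by rewrite starD starK addrC.
- by rewrite convolDr Qf Qsf.
have [||v fv] := @minimal_idem_sa Q (('i%C : R[i]) *: (f - star f)) mQ.
- rewrite starZ starD starN starK (_ : conjc 'i%C = - 'i%C); last by simpc.
  by rewrite scaleNr -scalerN opprB.
- by rewrite convolZr convolBr Qf Qsf.
have H : (2 : R[i]) *: f = (u - 'i%C * v) *: Q.
  rewrite scaler_nat mulr2n scalerBl -fu -scalerA -fv scalerA -expr2 sqr_i scaleN1r.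
  by apply: cfun_ext => x; rewrite !(cfunD, cfunN); ring.
exists (2^-1 * (u - 'i%C * v)); rewrite -scalerA -H scalerA mulVf ?scale1r //.
Qed.

(** The translates of [Q] lie in its ideal, so that they are multiples of [Q];
    the factor of proportionality is a character. *)
Lemma minimal_idem_char Q : minimal_idem Q ->
  exists2 chi : X -> cplx R, is_char chi & forall x, Q x = Q 0 * chi x.
Proof.
move=> mQ; have [iQ _] := mQ; have [sQ QQ Q0] := iQ.
have t0 := nrm2_gt0 Xcompact Q0; have Q00 := idem_at0 iQ.
have Q0n : Q 0 != 0 by rewrite Q00 (fmorph_eq0 (real_complex R)) gt_eqF.
have Qshift y x : Q (x + y) = Q y / Q 0 * Q x.
  have [|l Hl] := @minimal_idem_line Q (cshift y Q) mQ.
    by rewrite convolC convol_shift QQ.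
  have E z : Q (z + y) = l * Q z by have /(congr1 (fun f : cfun => f z)) := Hl.
  by have := E 0; rewrite add0r => ->; rewrite E mulfK.
pose chi x := Q x / Q 0.
have chiD x y : chi (x + y) = chi x * chi y by rewrite /chi Qshift; field.
have chi0 : chi 0 = 1 by rewrite /chi divff.
have chi_le x : normc (chi x) <= 1.
  rewrite /chi normcM normcV ler_pdivrMr ?normc_gt0 // mul1r Q00 normc_real ger0_norm ?(ltW t0) //.
  exact: (idem_le x iQ).
exists chi; last by move=> x; rewrite /chi mulrC divfK.
split=> //.
  by apply: ccontM; [exact: cfun_cont|exact: ccont_cst].
move=> x; apply/eqP; rewrite eq_le chi_le /=.
have : normc (chi x) * normc (chi (- x)) = 1 by rewrite -normcM -chiD subrr chi0 normc1.
by have := chi_le (- x); have := normc_ge0 (chi x); have := normc_ge0 (chi (- x)); nra.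
Qed.

(** For [g] the difference of [h] and its translate by [x0], the idempotents
    produced from [g * star g] are eigenvectors for a nonzero eigenvalue. If
    the character [chi] under such an idempotent were [1] at [x0], convolution
    by [chi] would kill [g]. *)
Lemma char_separation (h : cfun) (x0 : X) : h x0 != h 0 ->
  exists2 chi : X -> cplx R, is_char chi & chi x0 != 1.
Proof.
move=> hx; pose g := h - cshift x0 h.
have g0 : g != 0.
  apply/eqP => /(congr1 (fun f : cfun => f 0)) /eqP.
  by rewrite cfunB cfun0 subr_eq0 /= add0r eq_sym (negPf hx).
pose w := convol g (star g).
have sw : star w = w by rewrite /w convol_star starK convolC.
have w0 : w != 0.
  apply/eqP => /(congr1 (fun f : cfun => complex.Re (f 0))) /= E.
  have : complex.Re (w 0) = nrm2 g by rewrite /w convolE -(nrm2_reflect Xcompact 0 g).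
  by move=> E'; have := nrm2_gt0 Xcompact g0; rewrite -E' E ltxx.
have [E [rho [sE E0 EE rho0 wE]]] := power_idempotent Xcompact sw w0.
have rho_neq0 : (rho%:C%C : R[i]) != 0 by rewrite (fmorph_eq0 (real_complex R)) gt_eqF.
have [Q mQ EQ] := minimal_idem_exists (And3 sE EE E0).
have [chi cchi Qchi] := minimal_idem_char mQ; exists chi => //.
apply/eqP => chi1; have [[_ _ Q0] _] := mQ; case/eqP: Q0.
have [_ chiD _] := cchi.
have Qx0 : cshift x0 Q = Q.
  by apply: cfun_ext => x; rewrite /= [LHS]Qchi [RHS]Qchi chiD chi1 mulr1.
have gQ : convol g Q = 0.
  by rewrite convolBl convol_shift (convolC _ h) -convol_shift Qx0 subrr.
have wQ : convol w Q = 0 by rewrite /w (convolC _ g) -convolA gQ convol0r.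
by apply: (scalerI rho_neq0); rewrite scaler0 -EQ -convolZl -wE -convolA EQ -convolA wQ convol0r.
Qed.

End Characters.

Section CharTheory.
Variables (R : realType) (X : topologicalZmodType).
Implicit Types chi : X -> cplx R.

Lemma char0 chi : is_char chi -> chi 0 = 1.
Proof.
move=> [_ cD cn]; have c0 : chi 0 != 0.
  by apply/eqP => /normc_eq0P E; have := cn 0; rewrite E => /esym/eqP; rewrite oner_eq0.
by apply: (mulfI c0); rewrite mulr1 -cD addr0.
Qed.

Lemma charN chi x : is_char chi -> chi (- x) = conjc (chi x).
Proof.
move=> cc; have [_ cD cn] := cc.
have cx : chi x != 0.
  by apply/eqP => /normc_eq0P E; have := cn x; rewrite E => /esym/eqP; rewrite oner_eq0.
by apply: (mulfI cx); rewrite -cD subrr char0 // mulc_conj cn expr1n.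
Qed.

Lemma char_natmul chi x n : is_char chi -> chi (x *+ n) = chi x ^+ n.
Proof.
move=> cc; have [_ cD _] := cc; elim: n => [|n IH]; first by rewrite mulr0n char0.
by rewrite mulrS cD IH exprS.
Qed.

Lemma char_comp chi (f : X -> X) : is_char chi -> continuous f ->
  (forall x y, f (x + y) = f x + f y) -> is_char (fun x => chi (f x)).
Proof.
move=> [cc cD cn] cf fD; split=> [x|x y|x]; [|by rewrite fD cD|exact: cn].
by apply: (@continuous_comp _ _ _ f chi); [exact: cf|exact: cc].
Qed.

(** The mean of a nontrivial character is [0], by translation invariance. *)
Lemma mean_char_eq (Xcompact : compact [set: X]) chi b : is_char chi ->
  ((forall x, chi x = 1) -> b = 1) -> (b * mean chi) = mean chi.
Proof.
move=> [cc cD cn] Hb; have [/Hb ->|/existsNP[a /eqP ca]] := pselect (forall x, chi x = 1).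
  by rewrite mul1r.
suff -> : mean chi = 0 by rewrite mulr0.
have : mean chi = chi a * mean chi.
  rewrite -{1}(mean_shift Xcompact a cc) -(meanZ Xcompact _ cc); congr mean; apply/funext => x.
  by rewrite cD mulrC.
move/eqP; rewrite -subr_eq0 -{1}[mean chi]mul1r -mulrBl mulf_eq0 subr_eq0 eq_sym (negPf ca) /=.
by move/eqP.
Qed.

Lemma open_neq (f : X -> cplx R) (c : cplx R) : continuous f -> open [set x | f x != c].
Proof.
move=> /continuouscP cf; rewrite openE => x /= fx.
have n0 : 0 < normc (f x - c) by apply: normc_gt0; rewrite subr_eq0.
rewrite /interior; apply: filterS (cf x _ n0) => z /= H.
apply/eqP => fz; move: H; rewrite fz normc_distC ltxx //.
Qed.

(** If [z] is close to [1] then [1 + z + ... + z^n] is close to [n + 1], hence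
    nonzero, and it annihilates [z - 1]. *)
Lemma root_of_unity_near1 (z : cplx R) n : z ^+ n.+1 = 1 -> normc z = 1 ->
  normc (z - 1) * n.+1%:R < 1 -> z = 1.
Proof.
move=> zn z1 zs.
have pow_close i : normc (z ^+ i - 1) <= i%:R * normc (z - 1).
  elim: i => [|i IH]; first by rewrite expr0 subrr normc0 mul0r.
  have -> : z ^+ i.+1 - 1 = z * (z ^+ i - 1) + (z - 1) by rewrite exprS; ring.
  apply: le_trans (normcD _ _) _; rewrite normcM z1 mul1r -natr1 mulrDl mul1r.
  by rewrite lerD2r.
have /eqP : (z - 1) * (\sum_(i < n.+1) z ^+ i) = 0 by rewrite -subrX1 zn subrr.
rewrite mulf_eq0 subr_eq0 => /orP[/eqP //|/eqP S0]; exfalso.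
have : normc (\sum_(i < n.+1) (z ^+ i - 1)) <= n.+1%:R * (normc (z - 1) * n.+1%:R).
  apply: le_trans (normc_sum _ _) _.
  have -> : n.+1%:R * (normc (z - 1) * n.+1%:R) = \sum_(i < n.+1) (normc (z - 1) * n.+1%:R).
    by rewrite sumr_const card_ord mulr_natl.
  apply: ler_sum => i _; apply: le_trans (pow_close i) _.
  by rewrite mulrC ler_wpM2l ?normc_ge0 // ler_nat ltnW // ltn_ord.
rewrite sumrB S0 sub0r normcN sumr_const card_ord normc_natr.
by rewrite -[leLHS]mulr1 ler_pM2l ?ltr0n // leNgt zs.
Qed.

(** The kernel of a character of finite order is open and closed. *)
Lemma char_torsion_free (Xconnected : connected [set: X]) chi n :
  is_char chi -> (forall x, chi x ^+ n.+1 = 1) -> forall x, chi x = 1.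
Proof.
move=> cc chin; have [ccont cD cn] := cc.
suff H : [set x | chi x = 1] = [set: X].
  by move=> x; have : [set: X] x by []; rewrite -H.
apply: Xconnected.
- by exists 0; exact: char0.
- exists [set x | chi x = 1]; last by rewrite setTI.
  rewrite openE => x /= chix; rewrite /interior.
  have /continuouscP/(_ x (n.+2%:R^-1)) := ccont.
  rewrite invr_gt0 ltr0n => /(_ isT); apply: filterS => z; rewrite chix => H.
  apply: (@root_of_unity_near1 _ n) => //.
  have n0 : 0 < n.+1%:R :> R by rewrite ltr0n.
  apply: le_lt_trans (_ : n.+2%:R^-1 * n.+1%:R < 1); first by rewrite ler_pM2r // ltW.
  by rewrite mulrC ltr_pdivrMr ?ltr0n // mul1r ltr_nat.
- exists [set x | chi x = 1]; last by rewrite setTI.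
  have -> : [set x | chi x = 1] = ~` [set x | chi x != 1].
    by apply/seteqP; split=> x /= ; [move=> ->; rewrite eqxx|move=> /negP; rewrite negbK => /eqP].
  by apply: open_closedC; exact: open_neq.
Qed.

End CharTheory.

(** * Affine maps on a factor generated by characters *)

Section FixedPoint.
Variables (R : realType) (X : topologicalZmodType) (Xcompact : compact [set: X]).
Variables (A : {additive X -> X}) (Acont : continuous A) (b : X).
Variables (I : zmodType) (sigma : I -> I) (D : I -> X -> cplx R).
Hypothesis Dchar : forall r, is_char (D r).
Hypothesis D0 : forall x, D 0 x = 1.
Hypothesis DD : forall r s x, D (r + s) x = D r x * D s x.
Hypothesis Dsigma : forall r x, D (sigma r) x = D r (A x).
Hypothesis Dfix : forall r, (forall x, D r (A x - x) = 1) -> D r b = 1.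

Let B x := A x - x.

Let Bcont : continuous B.
Proof.
move=> x; apply: (@continuous_comp _ _ _ (fun x => (A x, x)) (fun z : X * X => z.1 - z.2)).
  by apply: cvg_pair => /=; [exact: Acont|exact: cvg_id].
exact: sub_continuous.
Qed.

Let BD x y : B (x + y) = B x + B y.
Proof. by rewrite /B raddfD opprD addrACA. Qed.

Let B0 : B 0 = 0. Proof. by rewrite /B raddf0 subrr. Qed.

Let DN r x : D (- r) x = conjc (D r x).
Proof.
rewrite -(charN x (Dchar r)); have [_ cD _] := Dchar r.
have rx : D r x != 0.
  apply/eqP => /normc_eq0P E; have [_ _ cn] := Dchar r.
  by have := cn x; rewrite E => /esym/eqP; rewrite oner_eq0.
by apply: (mulfI rx); rewrite -DD -cD !subrr D0 (char0 (Dchar r)).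
Qed.

Let trig (s : seq (cplx R * I)) x : cplx R := \sum_(p <- s) p.1 * D p.2 x.

(** Trigonometric polynomials with frequencies in the family [D]. *)
Definition is_trig (f : X -> cplx R) := exists s, forall x, f x = trig s x.

Lemma trigD f g : is_trig f -> is_trig g -> is_trig (fun x => f x + g x).
Proof. by move=> [s fs] [t gt]; exists (s ++ t) => x; rewrite fs gt /trig big_cat. Qed.

Lemma trigM f g : is_trig f -> is_trig g -> is_trig (fun x => f x * g x).
Proof.
move=> [s fs] [t gt]; exists [seq (p.1 * q.1, p.2 + q.2) | p <- s, q <- t] => x.
rewrite fs gt /trig big_allpairs_dep mulr_suml; apply: eq_bigr => p _.
by rewrite mulr_sumr; apply: eq_bigr => q _ /=; rewrite DD; ring.
Qed.

Lemma trig_char r : is_trig (D r).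
Proof. by exists [:: (1, r)] => x; rewrite /trig big_seq1 mul1r. Qed.

Lemma trig_cst c : is_trig (fun=> c).
Proof. by exists [:: (c, 0)] => x; rewrite /trig big_seq1 D0 mulr1. Qed.

Lemma trigX f n : is_trig f -> is_trig (fun x => f x ^+ n).
Proof.
move=> tf; elim: n => [|n IH]; first exact: trig_cst.
by have := trigM tf IH; congr is_trig; apply/funext => x; rewrite exprS.
Qed.

Lemma trig_sum (J : Type) (s : seq J) (F : J -> X -> cplx R) :
  (forall j, is_trig (F j)) -> is_trig (fun x => \sum_(j <- s) F j x).
Proof.
move=> tF; elim: s => [|j s IH].
  by exists [::] => x; rewrite /trig !big_nil.
by have := trigD (tF j) IH; congr is_trig; apply/funext => x; rewrite big_cons.
Qed.

Lemma trig_cont f : is_trig f -> continuous f.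
Proof.
move=> [s fs]; have -> : f = trig s by apply/funext.
apply: ccont_sum => p; apply: ccontM; first exact: ccont_cst.
by have [cc _ _] := Dchar p.2.
Qed.

(** By linearity it is enough to compare [D r (B x)] and [D r (B x + b)]: both
    have mean [0] unless [D r o B] is trivial, and then the hypothesis gives
    [D r b = 1]. *)
Lemma mean_trig f : is_trig f ->
  mean (fun x => f (B x + b)) = mean (fun x => f (B x)).
Proof.
move=> [s fs].
have cDB r : is_char (fun x => D r (B x)) by exact: char_comp.
have ccDB r : continuous (fun x => D r (B x)) by have [cc _ _] := cDB r.
have -> : (fun x => f (B x + b)) = (fun x => \sum_(p <- s) (p.1 * D p.2 b) * D p.2 (B x)).
  apply/funext => x; rewrite fs; apply: eq_bigr => p _.
  by have [_ -> _] := Dchar p.2; ring.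
have -> : (fun x => f (B x)) = (fun x => \sum_(p <- s) p.1 * D p.2 (B x)).
  by apply/funext => x; rewrite fs.
have cs (a : cplx R) r : continuous (fun x => a * D r (B x)).
  by apply: ccontM; [exact: ccont_cst|exact: ccDB].
rewrite !(mean_sum Xcompact) //; apply: eq_bigr => p _.
rewrite !(meanZ Xcompact _ (@ccDB p.2)) -mulrA; congr (_ * _).
by apply: mean_char_eq => // H; exact: Dfix.
Qed.

(** Let [u] be the sum of the [2 + 2 Re eta_j], which takes values in the
    interval from [0] to [K] and the value [K] exactly where all the [eta_j]
    are [1]. As [u 0 = K], the means of the powers of [u (B x)] decay more
    slowly than any [d ^ N] with [d < K]. These means are also those of the
    powers of [u (B x + b)] by [mean_trig], so that [u (B x + b)] attains
    [K]. *)
Lemma finite_fixed_point r m : exists x, forall j, (j <= m)%N -> D (iter j sigma r) (B x + b) = 1.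
Proof.
pose eta j := D (iter j sigma r).
pose u x : R := \sum_(j < m.+1) (2 + 2 * complex.Re (eta j x)).
have Re_eta j x : complex.Re (eta j x) <= 1.
  have [_ _ cn] := Dchar (iter j sigma r).
  by apply: le_trans (ler_norm _) _; apply: le_trans (Re_le_normc _) _; rewrite cn.
have Re_eta' j x : -1 <= complex.Re (eta j x).
  have [_ _ cn] := Dchar (iter j sigma r).
  rewrite lerNl; apply: le_trans (ler_norm _) _; rewrite normrN.
  by apply: le_trans (Re_le_normc _) _; rewrite cn.
have ut : is_trig (fun x => (u x)%:C%C).
  have -> : (fun x => (u x)%:C%C : cplx R) =
      (fun x => \sum_(j < m.+1) (2 + (eta j x + D (- iter j sigma r) x))).
    apply/funext => x; rewrite rmorph_sum; apply: eq_bigr => j _.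
    rewrite DN /eta; case: (D _ x) => a c; simpc; congr (_ +i* _)%C; rewrite /=; ring.
  apply: trig_sum => j; apply: (trigD (trig_cst 2)).
  by apply: trigD; exact: trig_char.
pose K : R := 4 * m.+1%:R.
have K0 : 0 < K by rewrite mulr_gt0 // ltr0n.
have KE : K = \sum_(j < m.+1) 4 by rewrite /K sumr_const card_ord mulr_natr.
have uK x : u x <= K.
  by rewrite KE; apply: ler_sum => j _; have := Re_eta j x; lra.
have u0 x : 0 <= u x by apply: sumr_ge0 => j _; have := Re_eta' j x; lra.
have eta_max x : u x = K -> forall j, (j <= m)%N -> eta j x = 1.
  move=> uxK j jm.
  have /eqP : \sum_(j < m.+1) (4 - (2 + 2 * complex.Re (eta j x))) = 0.
    by rewrite sumrB -KE -uxK subrr.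
  rewrite psumr_eq0; last by move=> i _; have := Re_eta i x; lra.
  move=> /allP /(_ (Ordinal (jm : (j < m.+1)%N)) (mem_index_enum _)) /= /eqP H.
  have {}H : complex.Re (eta j x) = 1 by lra.
  have [_ _ cn] := Dchar (iter j sigma r); have := cn x; rewrite -/(eta j).
  have := mulc_conj (eta j x); rewrite -/(eta j) => + n1; rewrite n1 expr1n.
  case: (eta j x) H => a c /= -> /(congr1 (@complex.Re R)) /= E.
  have /eqP : c ^+ 2 = 0 by nra.
  by rewrite sqrf_eq0 => /eqP ->.
have ucont : continuous u by move: (trig_cont ut) => /cont_Re.
apply: contrapT => nofix.
have ult x : u (B x + b) < K.
  rewrite lt_neqAle uK andbT; apply/eqP => E; apply: nofix; exists x => j jm.
  exact: eta_max jm.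
have shcont : continuous (fun x => u (B x + b)).
  move=> x; apply: (@continuous_comp _ _ _ (fun x => B x + b) u); last exact: ucont.
  apply: (@continuous_comp _ _ _ B (fun y => y + b)); first exact: Bcont.
  exact: cont_addr.
have Bucont : continuous (fun x => u (B x)).
  by move=> x; apply: (@continuous_comp _ _ _ B u); [exact: Bcont|exact: ucont].
have [q /= [q0 qK] uq] : exists2 q : R, 0 <= q /\ q < K & forall x, u (B x + b) <= q.
  apply: (compact_select Xcompact (L := [set q : R | 0 <= q /\ q < K])
     (P := fun q x => u (B x + b) <= q)).
  - by exists 0.
  - move=> g h [g0 gK] [h0 hK]; exists (Num.max g h).
      by split; [rewrite le_max g0|rewrite gt_max gK].
    by move=> z [] H; rewrite le_max H ?orbT.
  - move=> x; exists ((u (B x + b) + K) / 2).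
      by split; have := ult x; have := u0 (B x + b); lra.
    have := ult x => ux.
    have /cvgrPdistC_lt/(_ ((K - u (B x + b)) / 2) ltac:(lra)) := shcont x.
    by apply: filterS => z; rewrite ltr_norml => /andP[_]; lra.
pose d := (q + K) / 2.
have u00 : u (B 0) = K.
  rewrite KE; apply: eq_bigr => j _; rewrite /eta B0 char0 //=; ring.
have V0 : nbhs (0 : X) [set v | d <= u (B v)].
  have /cvgrPdistC_lt/(_ (K - d) ltac:(rewrite /d; lra)) := Bucont 0.
  by apply: filterS => z /=; rewrite u00 ltr_norml => /andP[H _]; lra.
have [k k0 Hk] := @mean_lower R _ Xcompact _ V0.
have d0 : 0 < d by rewrite /d; lra.
have key N : k * d ^+ N <= q ^+ N.
  have [f ft fE] : exists2 f : X -> cplx R, is_trig f & forall x, f x = (u x ^+ N)%:C%C.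
    by exists (fun x => (u x)%:C%C ^+ N : cplx R); [exact: trigX|move=> x; rewrite rmorphXn].
  have fc := trig_cont ft.
  have c1 : continuous (fun x => f (B x)).
    by move=> x; apply: (@continuous_comp _ _ _ B f); [exact: Bcont|exact: fc].
  have c2 : continuous (fun x => f (B x + b)).
    move=> x; apply: (@continuous_comp _ _ _ (fun x => B x + b) f); last exact: fc.
    apply: (@continuous_comp _ _ _ B (fun y => y + b)); first exact: Bcont.
    exact: cont_addr.
  apply: (@le_trans _ _ (complex.Re (mean (fun x => f (B x))))).
    apply: Hk; first exact: c1.
      by move=> x; rewrite fE /= exprn_ge0.
    move=> v /= Vv; rewrite fE /= lerXn2r ?nnegrE ?(ltW d0) //.
  rewrite -(mean_trig ft).
  apply: le_trans (ler_norm _) _; apply: le_trans (Re_le_normc _) _.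
  apply: (mean_le Xcompact); first exact: c2.
  move=> x; rewrite fE normc_real normrX lerXn2r ?nnegrE ?normr_ge0 //.
  by rewrite ger0_norm.
have qd : q / d < 1 by rewrite ltr_pdivrMr // mul1r /d; lra.
have : (fun n => geometric 1 (q / d) n) @ \oo --> (0 : R).
  by apply: cvg_geometric; rewrite ger0_norm // divr_ge0 // ltW.
move=> /cvgrPdistC_lt/(_ k k0) [N _ HN].
have := HN N (leqnn N); rewrite /= mul1r subr0 ger0_norm; last by rewrite exprn_ge0 // divr_ge0 // ltW.
rewrite exprMn exprVn ltr_pdivrMr ?exprn_gt0 // ltNge key //.
Qed.

(** A cluster point of solutions of the first [m] conditions, as [m] grows,
    solves all of them. *)
Lemma fixed_point r : exists x, forall j, D (iter j sigma r) (B x + b) = 1.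
Proof.
have /choice[xs Hxs] := finite_fixed_point r.
have [|x0 [_ clx]] := Xcompact (F := xs @ \oo) _; first exact: filterT.
exists x0 => j; apply/eqP; apply: contrapT => /negP H.
pose f x := D (iter j sigma r) (B x + b).
have cf : continuous f.
  move=> x; apply: (@continuous_comp _ _ _ (fun x => B x + b) (D (iter j sigma r))).
    apply: (@continuous_comp _ _ _ B (fun y => y + b)); first exact: Bcont.
    exact: cont_addr.
  by have [cc _ _] := Dchar (iter j sigma r); exact: cc.
have [|| z []] := clx [set x | f x = 1] [set x | f x != 1].
- by exists j => // n /= jn; exact: Hxs.
- by move: (@open_neq _ _ f 1 cf); rewrite openE => /(_ x0 H).
- by move=> /= -> /eqP.
Qed.

(** If [x0] is a fixed point modulo the common kernel of the [D (sigma^j r)],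
    the coset of [x0] by this kernel is closed and invariant under [T], so it
    is everything; as the kernel is a group, it is everything too. *)
Lemma fixed_trivial_of_minimal (T : X -> X) : (forall x, T x = A x + b) -> minimal_map T ->
  forall r x, D r x = 1.
Proof.
move=> TE Tmin r x; have [x0 Hx0] := fixed_point r.
have inv n j : D (iter j sigma r) (iter n T x0 - x0) = 1.
  elim: n j => [|n IH] j; first by rewrite /= subrr char0.
  have -> : iter n.+1 T x0 - x0 = A (iter n T x0 - x0) + (B x0 + b).
    by rewrite iterS TE raddfB /B addrA [X in _ = X + _]addrA subrK addrAC.
  have [_ -> _] := Dchar (iter j sigma r).
  by rewrite Hx0 mulr1 -Dsigma; exact: (IH j.+1).
apply/eqP; apply: contrapT => /negP H.
have cf : continuous (fun y => D r (y - x0)).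
  move=> y; apply: (@continuous_comp _ _ _ (fun y => y - x0) (D r)); first exact: cont_addr.
  by have [cc _ _] := Dchar r; exact: cc.
have [||y [/= H1 [n _ H2]]] := Tmin x0 [set y | D r (y - x0) != 1].
- by exists (x + x0) => /=; rewrite addrK.
- exact: open_neq.
- by move: H1; rewrite -H2 (inv n 0%N) eqxx.
Qed.

End FixedPoint.

(** * Unipotence of minimal affine maps *)

Section PolyAction.
Variables (X : zmodType) (A : {additive X -> X}).
Implicit Types (p q : {poly int}).

(** The value at [x] of the endomorphism [p(A)]. *)
Definition pact p (x : X) : X := \sum_(i < size p) iter i A x *~ p`_i.

Lemma pactE n p x : (size p <= n)%N -> pact p x = \sum_(i < n) iter i A x *~ p`_i.
Proof.
move=> pn; rewrite /pact (big_ord_widen n (fun i => iter i A x *~ p`_i)) // big_mkcond /=.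
apply: eq_bigr => i _; case: ltnP => // H.
by rewrite nth_default // mulr0z.
Qed.

Lemma pactD p q x : pact (p + q) x = pact p x + pact q x.
Proof.
rewrite !(@pactE (maxn (size p) (size q))) ?leq_maxl ?leq_maxr ?size_polyD //.
by rewrite -big_split; apply: eq_bigr => i _; rewrite coefD mulrzDr.
Qed.

Lemma pact0 x : pact 0 x = 0.
Proof. by rewrite /pact size_poly0 big_ord0. Qed.

Lemma pactC (c : int) x : pact c%:P x = x *~ c.
Proof.
by rewrite (@pactE 1%N) ?size_polyC_leq1 // big_ord1 coefC eqxx.
Qed.

Lemma iter_raddf i x y : iter i A (x + y) = iter i A x + iter i A y.
Proof. by elim: i => //= i ->; rewrite raddfD. Qed.

Lemma pact_raddf p x y : pact p (x + y) = pact p x + pact p y.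
Proof.
by rewrite /pact -big_split; apply: eq_bigr => i _; rewrite iter_raddf mulrzDl.
Qed.

Lemma pactN p x : pact (- p) x = - pact p x.
Proof. by apply: (addIr (pact p x)); rewrite -pactD !addNr pact0. Qed.

Lemma pactMX p x : pact (p * 'X) x = pact p (A x).
Proof.
have [->|p0] := eqVneq p 0; first by rewrite mul0r !pact0.
rewrite /pact size_mulX // big_ord_recl coefMX /= mulr0z add0r.
by apply: eq_bigr => i _; rewrite coefMX /= -iterSr.
Qed.

Lemma pact_comm p x : pact p (A x) = A (pact p x).
Proof.
rewrite /pact raddf_sum; apply: eq_bigr => i _.
by rewrite raddfMz -iterSr.
Qed.

Lemma pactZ c p x : pact (c *: p) x = pact p x *~ c.
Proof.
rewrite (@pactE (size p)) ?size_scale_leq // /pact mulrz_suml.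
by apply: eq_bigr => i _; rewrite coefZ mulrC mulrzA.
Qed.

Lemma pactM p q x : pact (p * q) x = pact p (pact q x).
Proof.
elim/poly_ind: p x => [|p c IH] x; first by rewrite mul0r !pact0.
have -> : (p * 'X + c%:P) * q = p * q * 'X + c *: q by rewrite -mul_polyC; ring.
by rewrite !pactD pactZ !pactMX IH pact_comm pactC.
Qed.

Lemma pactX_sub1 x : pact ('X - 1%:P) x = A x - x.
Proof. by rewrite pactD pactN pactC mulr1z -['X]mul1r pactMX -[1]/(1%:P) pactC mulr1z. Qed.

Lemma pactXn_sub1 k x : pact (('X - 1%:P) ^+ k) x = iter k (fun y => A y - y) x.
Proof.
elim: k x => [|k IH] x; first by rewrite expr0 -[1]/(1%:P) pactC mulr1z.
rewrite exprSr pactM IH iterSr; congr (iter _ _ _).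
exact: pactX_sub1.
Qed.

End PolyAction.

Section Unipotent.
Variables (R : realType) (X : topologicalZmodType) (Xcompact : compact [set: X]).
Variable Xconnected : connected [set: X].
Variables (A : {additive X -> X}) (Acont : continuous A) (b : X) (T : X -> X).
Hypothesis TE : forall x, T x = A x + b.
Hypothesis Tmin : minimal_map T.

Lemma iter_cont i : continuous (iter i A).
Proof.
elim: i => [|i IH] x; first exact: cvg_id.
by apply: (@continuous_comp _ _ _ (iter i A) A); [exact: IH|exact: Acont].
Qed.

Lemma pact_cont p : continuous (pact A p).
Proof.
have cD (f g : X -> X) : continuous f -> continuous g -> continuous (fun x => f x + g x).
  move=> cf cg x; apply: (@continuous_comp _ _ _ (fun x => (f x, g x)) (fun z : X * X => z.1 + z.2)).
    by apply: cvg_pair; [exact: cf|exact: cg].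
  exact: add_continuous.
have cn (f : X -> X) n : continuous f -> continuous (fun x => f x *+ n).
  move=> cf; elim: n => [|n IH]; first by move=> x; exact: cvg_cst.
  rewrite (_ : (fun x => f x *+ n.+1) = (fun x => f x + f x *+ n)); first exact: cD.
  by apply/funext => x; rewrite mulrS.
have cz (f : X -> X) (n : int) : continuous f -> continuous (fun x => f x *~ n).
  move=> cf; case: n => n; first exact: cn.
  move=> x; apply: (@continuous_comp _ _ _ (fun x => f x *+ n.+1) -%R); first exact: cn.
  exact: opp_continuous.
rewrite /pact; elim: (index_enum _) => [|i s IH].
  rewrite (_ : (fun x => _) = (fun=> 0)); first by move=> x; exact: cvg_cst.
  by apply/funext => x; rewrite big_nil.
rewrite (_ : (fun x => _) = (fun x => iter i A x *~ p`_i + \sum_(i <- s) iter i A x *~ p`_i)).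
  by apply: cD => //; apply: cz; exact: iter_cont.
by apply/funext => x; rewrite big_cons.
Qed.

(** In both cases [fixed_trivial_of_minimal] is applied to a family
    [r |-> g o r(A)], and its hypothesis concerns the [r] for which [g o r(A)]
    is [A]-invariant. *)
Theorem char_unipotent (chi : X -> cplx R) : is_char chi ->
  exists k, forall x, chi (iter k (fun y => A y - y) x) = 1.
Proof.
move=> cchi.
have trivial (g : X -> cplx R) : is_char g ->
   (forall r : {poly int}, (forall x, g (pact A r (A x - x)) = 1) -> g (pact A r b) = 1) ->
   forall x, g x = 1.
  move=> cg Hg x.
  have := @fixed_trivial_of_minimal R X Xcompact A Acont b {poly int} (fun r => r * 'X)
    (fun r x => g (pact A r x)) _ _ _ _ Hg T TE Tmin 1 x.
  have P1 : pact A 1 x = x by rewrite -[1]/(1%:P) pactC mulr1z.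
  rewrite P1; apply.
  - by move=> r; apply: char_comp => //; [exact: pact_cont|exact: pact_raddf].
  - by move=> y; rewrite pact0 char0.
  - by move=> r s y; rewrite pactD; have [_ -> _] := cg.
  - by move=> r y; rewrite pactMX.
have [[f [f0 Hf]]|H] := pselect (exists f, f != 0 /\ forall x, chi (pact A f x) = 1); last first.
  exists 0%N; apply: (trivial chi cchi) => r Hr.
  have [->|r0] := eqVneq r 0; first by rewrite pact0 char0.
  case: H; exists (r * ('X - 1%:P)); split; first by rewrite mulf_neq0 // polyXsubC_eq0.
  by move=> x; rewrite pactM pactX_sub1 Hr.
have [k [g]] := multiplicity_XsubC f 1; rewrite f0 /= => g1 fE.
have [cont_chi chiD chin] := cchi.
exists k; pose chi' x := chi (pact A (('X - 1%:P) ^+ k) x).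
suff H : forall x, chi' x = 1 by move=> x; rewrite -pactXn_sub1; exact: H.
have cchi' : is_char chi'.
  by apply: char_comp => //; [exact: pact_cont|exact: pact_raddf].
have Hg x : chi' (pact A g x) = 1 by rewrite /chi' -pactM mulrC -fE Hf.
apply: trivial => // r Hr.
pose eta x := chi' (pact A r x).
have ceta : is_char eta by apply: char_comp => //; [exact: pact_cont|exact: pact_raddf].
have etaB x : eta (A x - x) = 1 by exact: Hr.
(* On the [A]-invariant character [eta] the operator [p(A)] acts as the integer
   [p(1)]. *)
have eta_pact p x : eta (pact A p x) = eta (x *~ p.[1]).
  have /factor_theorem[q Eq] : root (p - p.[1]%:P) 1.
    by rewrite rootE hornerD hornerN hornerC subrr.
  move: (p.[1]) Eq => c Eq; have -> : p = q * ('X - 1%:P) + c%:P by rewrite -Eq subrK.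
  rewrite pactD pactC.
  have [_ -> _] := ceta; by rewrite (mulrC q) pactM pactX_sub1 etaB mul1r.
have etan x : eta (x *~ g.[1]) = 1.
  by rewrite -eta_pact /eta -pactM mulrC pactM Hg.
have [n nE] : exists n, `|g.[1]|%N = n.+1.
  case E : `|g.[1]|%N => [|n]; last by exists n.
  by move/eqP: E; rewrite absz_eq0 -rootE (negPf g1).
apply: (char_torsion_free Xconnected ceta (n := n)) => x.
rewrite -(char_natmul _ _ ceta) -nE.
case: (g.[1]) etan => m etan /=; first by have := etan x; rewrite -pmulrn.
have := etan x; rewrite NegzE mulrNz -pmulrn (charN _ ceta) => /(congr1 (@conjc R)).
by rewrite conjcK conjc1.
Qed.

End Unipotent.

(** * Quasi-discrete spectrum *)

Section Span.
Variables (R : realType) (Y : topologicalType).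
Variable S : set (Y -> cplx R).

(** Linear combinations are generated one term at a time, which makes
    statements that are stable under linear combinations provable by
    induction. *)
Inductive span : (Y -> cplx R) -> Prop :=
| span0 : span (fun=> 0)
| span_cons c g f : S g -> span f -> span (fun x => c * g x + f x).

Lemma spanD f g : span f -> span g -> span (fun x => f x + g x).
Proof.
move=> sf sg; elim: sf => [|c h k Sh sk IH].
  by move: sg; congr span; apply/funext => x; rewrite add0r.
by have := span_cons c Sh IH; congr span; apply/funext => x; rewrite addrA.
Qed.

Lemma span_gen f : S f -> span f.
Proof.
move=> Sf; have := span_cons 1 Sf span0; congr span.
by apply/funext => x; rewrite mul1r addr0.
Qed.

Lemma spanM f g : (forall f g, S f -> S g -> S (fun x => f x * g x)) ->
  span f -> span g -> span (fun x => f x * g x).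
Proof.
move=> SM sf sg; elim: sf => [|c h k Sh sk IH].
  by have := span0; congr span; apply/funext => x; rewrite mul0r.
suff H : span (fun x => (c * h x) * g x).
  by have := spanD H IH; congr span; apply/funext => x; rewrite mulrDl.
elim: sg => [|d i j Si sj IHj].
  by have := span0; congr span; apply/funext => x; rewrite mulr0.
have := span_cons (c * d) (SM _ _ Sh Si) IHj; congr span.
by apply/funext => x; ring.
Qed.

Lemma span_conj f : (forall f, S f -> S (fun x => conjc (f x))) ->
  span f -> span (fun x => conjc (f x)).
Proof.
move=> SC; elim=> [|c g k Sg sk IH].
  by have := span0; congr span; apply/funext => x; rewrite conjc0.
have := span_cons (conjc c) (SC _ Sg) IH; congr span.
by apply/funext => x; rewrite conjc_add conjc_mul.
Qed.

Lemma span_cont f : (forall f, S f -> continuous f) -> span f -> continuous f.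
Proof.
move=> Sc; elim=> [|c g k Sg sk IH]; first exact: ccont_cst.
by apply: ccontD; [apply: ccontM; [exact: ccont_cst|exact: Sc]|exact: IH].
Qed.

(** Stone-Weierstrass when the algebra is spanned by a multiplicative
    family. *)
Lemma span_dense : compact [set: Y] ->
  (forall f, S f -> continuous f) -> S (fun=> 1) ->
  (forall f g, S f -> S g -> S (fun x => f x * g x)) ->
  (forall f, S f -> S (fun x => conjc (f x))) ->
  (forall x y, x != y -> exists2 f, S f & f x != f y) ->
  forall f, continuous f -> forall e : R, 0 < e ->
  exists2 g, span g & forall x, normc (f x - g x) <= e.
Proof.
move=> Yc Sc S1 SM SC Ssep f cf e e0.
apply: (stone_weierstrass Yc) cf _ e0.
- by move=> g; exact: span_cont.
- move=> c; have := span_cons c S1 span0; congr span.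
  by apply/funext => x; rewrite mulr1 addr0.
- exact: spanD.
- by move=> g h; exact: spanM.
- by move=> g; exact: span_conj.
- by move=> x y xy; have [g Sg gxy] := Ssep x y xy; exists g => //; exact: span_gen.
Qed.

End Span.

Section CharAlgebra.
Variables (R : realType) (X : topologicalZmodType).
Implicit Types chi psi : X -> cplx R.

Lemma char_one : is_char (fun _ : X => 1 : cplx R).
Proof.
split=> [|x y|x]; [exact: ccont_cst|by rewrite mulr1|exact: normc1].
Qed.

Lemma charM chi psi : is_char chi -> is_char psi -> is_char (fun x => chi x * psi x).
Proof.
move=> [cc cD cn] [dc dD dn]; split=> [|x y|x]; first by apply: ccontM; [exact: cc|exact: dc].
  by rewrite cD dD; ring.
by rewrite normcM cn dn mulr1.
Qed.

Lemma char_conj chi : is_char chi -> is_char (fun x => conjc (chi x) : cplx R).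
Proof.
move=> [cc cD cn]; split=> [|x y|x]; first by apply: ccont_conj; exact: cc.
  by rewrite cD conjc_mul.
by rewrite normc_conj.
Qed.

(** The distance to [0] is a continuous function that distinguishes [x - y]
    from [0]. *)
Lemma chars_separate (Xcompact : compact [set: X]) (Xm : metrizable R X) (x y : X) :
  x != y -> exists2 chi : X -> cplx R, is_char chi & chi x != chi y.
Proof.
case: Xm => dist [d0 deq dC dtri dnbhs] xy.
have ch : continuous (fun z => (dist z 0)%:C%C : cplx R).
  apply: ccont_real => z; apply/cvgrPdistC_lt => e e0.
  apply/dnbhs; exists e => // t /= zt; apply: le_lt_trans zt.
  rewrite ler_norml; have := dtri t z 0; have := dtri z t 0; rewrite (dC t z).
  by move=> ? ?; apply/andP; split; lra.
have [|chi cchi chi1] := @char_separation R X Xcompact (Cfun ch) (x - y).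
  apply/eqP => /= /complexI; rewrite [RHS](_ : _ = 0); last exact/deq.
  by move=> /deq/eqP; rewrite subr_eq0 (negPf xy).
exists chi => //; apply: contra chi1 => /eqP E; have [_ cD cn] := cchi.
by rewrite cD (charN y cchi) E mulc_conj cn expr1n.
Qed.

End CharAlgebra.

Section QuasiEigen.
Variables (R : realType) (X : topologicalZmodType) (Xcompact : compact [set: X]).
Variable Xconnected : connected [set: X].
Variables (A : {additive X -> X}) (Acont : continuous A) (b : X) (T : X -> X).
Hypothesis TE : forall x, T x = A x + b.
Hypothesis Tmin : minimal_map T.

Lemma unimodularE (f : X -> cplx R) : continuous f -> (forall x, normc (f x) = 1) ->
  unimodular f.
Proof. by move=> cf fn; split=> [|x]; [exact: cf|rewrite normcE fn]. Qed.

Lemma B_cont : continuous (fun x => A x - x).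
Proof.
move=> x; apply: (@continuous_comp _ _ _ (fun x => (A x, x)) (fun z : X * X => z.1 - z.2)).
  by apply: cvg_pair => /=; [exact: Acont|exact: cvg_id].
exact: sub_continuous.
Qed.

(** [chi (T x) = chi b * chi (B x) * chi x], and [chi o B] is killed by one
    power of [B] less. *)
Lemma unipotent_quasi_eigen k (c : cplx R) (chi : X -> cplx R) :
  is_char chi -> normc c = 1 -> (forall x, chi (iter k (fun y => A y - y) x) = 1) ->
  quasi_eigen T k.+1 (fun x => c * chi x).
Proof.
elim: k c chi => [|k IH] c chi cchi c1 chik.
  split; last by exists 1 => x; rewrite mul1r (chik x) (chik (T x)).
  have [cc _ cn] := cchi; apply: unimodularE.
    by apply: ccontM; [exact: ccont_cst|exact: cc].
  by move=> x; rewrite normcM c1 cn mulr1.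
have [cc cD cn] := cchi; split.
  apply: unimodularE; first by apply: ccontM; [exact: ccont_cst|exact: cc].
  by move=> x; rewrite normcM c1 cn mulr1.
exists (fun x => chi b * chi (A x - x)).
  apply: (IH (chi b) (fun x => chi (A x - x))) => [||x].
  - by apply: char_comp; [exact: cchi|exact: B_cont|move=> x y; rewrite raddfD opprD addrACA].
  - exact: cn.
  - by rewrite -[RHS](chik x) iterS.
move=> x; rewrite TE -{1}(subrK x (A x)) !cD; ring.
Qed.

Lemma char_quasi_eigenfunction (chi : X -> cplx R) : is_char chi -> quasi_eigenfunctions T chi.
Proof.
move=> cchi; have [k Hk] := char_unipotent Xcompact Xconnected Acont TE Tmin cchi.
exists k.+1 => //; have := @unipotent_quasi_eigen k 1 chi cchi (normc1 R) Hk.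
by congr quasi_eigen; apply/funext => x; rewrite mul1r.
Qed.

Lemma quasi_discrete_spectrum (Xm : metrizable R X) : has_quasi_discrete_spectrum R T.
Proof.
split.
- move=> x; rewrite (_ : T = fun x => A x + b); last exact/funext.
  by apply: (@continuous_comp _ _ _ A (fun y => y + b)); [exact: Acont|exact: cont_addr].
- by exists 0; exact: Tmin.
move=> f cf e e0.
have [g sg fg] : exists2 g, span (@is_char R X) g & forall x, normc (f x - g x) <= e / 2.
  apply: span_dense cf _ _ => //.
  - by move=> g [].
  - exact: char_one.
  - exact: charM.
  - exact: char_conj.
  - by move=> x y; exact: chars_separate.
  - lra.
exists g; last by move=> x; rewrite normcE ltcR; apply: le_lt_trans (fg x) _; lra.
move=> S [[SD SM SZ] Ssub]; elim: sg => [|c h k ch _ IH].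
  have := SZ 0 _ (Ssub _ (char_quasi_eigenfunction (@char_one R X))).
  by congr S; apply/funext => x; rewrite mul0r.
by apply: SD => //; apply: SZ; apply: Ssub; exact: char_quasi_eigenfunction.
Qed.

End QuasiEigen.

(** * Polynomial phases along orbits *)

Section Phases.
Variable R : realType.

Lemma expi2piD (s t : R) : expi2pi (s + t) = expi2pi s * expi2pi t.
Proof.
rewrite /expi2pi mulrDr cosD sinD -[RHS]/(_ +i* _)%C; congr (_ +i* _)%C; ring.
Qed.

Lemma expi2pi0 : expi2pi 0 = 1 :> cplx R.
Proof. by rewrite /expi2pi mulr0 cos0 sin0. Qed.

Lemma expi2pi_surj (z : cplx R) : normc z = 1 -> exists t, z = expi2pi t.
Proof.
case: z => a c /= H.
have E : a ^+ 2 + c ^+ 2 = 1.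
  by rewrite -[LHS]sqr_sqrtr ?addr_ge0 ?sqr_ge0 // H expr1n.
have a1 : -1 <= a <= 1 by nra.
have pi2 : 2 * pi != 0 :> R by rewrite mulf_neq0 // gt_eqF // pi_gt0.
have sE : sin (acos a) = `|c|.
  by rewrite sin_acos // -sqrtr_sqr; congr Num.sqrt; lra.
have cE : cos (acos a) = a by apply: acosK; rewrite in_itv.
have [c0|c0] := ger0P c.
  exists (acos a / (2 * pi)); rewrite /expi2pi mulrC divfK //.
  by rewrite cE sE ger0_norm.
exists (- acos a / (2 * pi)); rewrite /expi2pi mulrC divfK //.
by rewrite cosN sinN cE sE ltr0_norm // opprK.
Qed.

(** The coefficient of degree [n] is removed by a multiple of the difference of
    [X^(n+1)]. *)
Lemma antidifference (n : nat) (P : {poly R}) : (size P <= n)%N ->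
  exists2 S : {poly R}, (size S <= n.+1)%N &
    forall x, S.[x + 1] - S.[x] = P.[x].
Proof.
elim: n P => [|n IH] P Pn.
  exists 0; first by rewrite size_poly0.
  by move=> x; move: Pn; rewrite leqn0 size_poly_eq0 => /eqP ->; rewrite !horner0 subrr.
have n0 : n.+1%:R != 0 :> R by rewrite pnatr_eq0.
pose a := P`_n / n.+1%:R.
pose dU : {poly R} := a *: \sum_(i < n.+1) 'X^i *+ 'C(n.+1, i).
have [|S Sn SE] := IH (P - dU).
  apply/leq_sizeP => j; rewrite leq_eqVlt => /orP[/eqP <-|nj].
    rewrite coefB coefZ coef_sum (bigD1 ord_max) //= big1 ?addr0.
      by rewrite coefMn coefXn eqxx binSn /a divfK // subrr.
    move=> i /eqP inen; rewrite coefMn coefXn (_ : (n == i) = false) ?mul0rn //.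
    by apply/negP => /eqP E; apply: inen; apply: val_inj.
  rewrite coefB coefZ coef_sum big1 ?mulr0 ?subr0.
    by rewrite nth_default // (leq_trans Pn).
  move=> i _; rewrite coefMn coefXn gtn_eqF ?mul0rn //.
  by rewrite (leq_trans (ltn_ord i)).
exists (S + a *: 'X^(n.+1)).
  rewrite (leq_trans (size_polyD _ _)) // geq_max (leq_trans Sn) //=.
  by rewrite (leq_trans (size_scale_leq _ _)) // size_polyXn.
move=> x; rewrite !(hornerD, hornerZ, hornerXn) opprD addrACA SE hornerD hornerN.
have -> : dU.[x] = a * ((x + 1) ^+ n.+1 - x ^+ n.+1).
  rewrite exprD1n big_ord_recr /= binn mulr1n addrK /dU hornerZ; congr (_ * _).
  by rewrite horner_sum; apply: eq_bigr => i _; rewrite hornerMn hornerXn.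
by rewrite mulrBr; ring.
Qed.

End Phases.

Section QuasiEigenPhase.
Variables (R : realType) (X : topologicalType) (T : X -> X).

Lemma unimodular_normc (f : X -> cplx R) x : unimodular f -> normc (f x) = 1.
Proof. by move=> [_ /(_ x)]; rewrite normcE => /complexI. Qed.

Lemma quasi_eigen_unimodular d (f : X -> cplx R) : quasi_eigen T d f -> unimodular f.
Proof. by case: d => [|[|d]] // []. Qed.

(** The ratio of consecutive values of [f] along the orbit is constant when
    [d = 1], and a value of the multiplier otherwise; its phase is a
    polynomial, of which [P] is a discrete antiderivative. *)
Lemma quasi_eigen_phase d (f : X -> cplx R) x : quasi_eigen T d f ->
  exists2 P : {poly R}, (size P <= d.+1)%N &
    forall m, f (iter m T x) = expi2pi P.[m%:R].
Proof.
elim: d f => [//|d IH] f fd.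
have uf := quasi_eigen_unimodular fd.
have [g0 Pg]: exists2 Q : {poly R}, (size Q <= d.+1)%N &
    forall m, f (iter m.+1 T x) = expi2pi Q.[m%:R] * f (iter m T x).
  case: d IH fd => [|d] IH fd.
    have [_ [lam Hlam]] := fd.
    have [|t tE] := @expi2pi_surj R lam.
      have := unimodular_normc (T x) uf; rewrite Hlam normcM (unimodular_normc _ uf).
      by rewrite mulr1.
    exists t%:P; first exact: size_polyC_leq1.
    by move=> m; rewrite hornerC -tE iterS Hlam.
  have [_ [g gd Hg]] := fd; have [Q Qs QE] := IH g gd; exists Q => //.
  by move=> m; rewrite iterS Hg QE.
move=> Hf; have [S Ss SE] := antidifference Pg.
have [t tE] := expi2pi_surj (unimodular_normc x uf).
exists (S + (t - S.[0])%:P).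
  by rewrite (leq_trans (size_polyD _ _)) // geq_max Ss (leq_trans (size_polyC_leq1 _)).
elim=> [|m IHm]; first by rewrite hornerD hornerC /= tE; congr expi2pi; ring.
rewrite Hf IHm -expi2piD !hornerD !hornerC; congr expi2pi.
by rewrite -SE -natr1; ring.
Qed.

Lemma quasi_eigen_step d (f : X -> cplx R) : (0 < d)%N -> quasi_eigen T d f -> quasi_eigen T d.+1 f.
Proof.
elim: d f => [//|[|d] IH] f _ fd.
  have uf := quasi_eigen_unimodular fd; have [_ [lam Hlam]] := fd.
  split=> //; exists (fun=> lam) => //; split; last by exists 1 => y; rewrite mul1r.
  split=> [|y]; first exact: ccont_cst.
  have [_ uf1] := uf; have := uf1 (T y); rewrite Hlam normrM uf1 mulr1 //.
have uf := quasi_eigen_unimodular fd; have [_ [g gd Hg]] := fd.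
by split=> //; exists g => //; exact: IH.
Qed.

Lemma quasi_eigen_le d e (f : X -> cplx R) : (0 < d)%N -> (d <= e)%N ->
  quasi_eigen T d f -> quasi_eigen T e f.
Proof.
move=> d0; elim: e => [|e IH]; first by rewrite leqn0 => /eqP dE; move: d0; rewrite dE.
rewrite leq_eqVlt => /orP[/eqP <- //|de fd].
by apply: quasi_eigen_step; [exact: leq_trans d0 de|exact: IH].
Qed.

(** The step from [G_n] to [G_{n+1}] depends on [G_n] only, so that the
    sequence is constant once two consecutive terms agree. *)
Lemma stationary_quasi_eigen d e (f : X -> cplx R) : stationary_at R T d -> (d <= e)%N ->
  quasi_eigen T e f -> quasi_eigen T d f.
Proof.
move=> [d0 Ed]; elim: e f => [|e IH] f; first by rewrite leqn0 => /eqP ->.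
rewrite leq_eqVlt => /orP[/eqP -> //|de]; rewrite ltnS in de.
case: d e d0 Ed de IH => [//|d] [//|e] d0 Ed de IH fe.
have uf := quasi_eigen_unimodular fe; have [_ [g ge Hg]] := fe.
rewrite Ed; split=> //; exists g => //; exact: IH.
Qed.

(** When the order is infinite any [d] is allowed, since full oscillation
    covers all degrees. *)
Lemma quasi_eigenfunction_order (f : X -> cplx R) : quasi_eigenfunctions T f ->
  exists2 d, quasi_eigen T d f & forall d', qds_order R T = Some d' -> d = d'.
Proof.
move=> [n n1 fn]; rewrite /qds_order; case: pselect => [h|_]; last by exists n.
case: ex_minnP => d /asboolP sd _; exists d; last by move=> d' [].
have [dn|nd] := leqP d n; first exact: stationary_quasi_eigen fn.
exact: quasi_eigen_le (ltnW nd) fn.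
Qed.

End QuasiEigenPhase.

(** * Averages along polynomial orbits *)

Section CesaroAverages.
Variable R : realType.
Implicit Types (c a u v : nat -> cplx R).

Definition vanishes u := average u N @[N --> \oo] --> (0 : cplx R).

Lemma vanishesP u : vanishes u <->
  forall e : R, 0 < e -> exists N0, forall N, (N0 <= N)%N -> normc (average u N) <= e.
Proof.
split=> [/cvgcP H e e0|H].
  by have [N0 _ HN] := H e e0; exists N0 => N NN; have := HN N NN; rewrite subr0 => /ltW.
apply/cvgcP => e e0; have [|N0 HN] := H (e / 2); first lra.
by exists N0 => // N /= NN; rewrite subr0; apply: le_lt_trans (HN N NN) _; lra.
Qed.

Lemma averageD u v N : average (fun n => u n + v n) N = average u N + average v N.
Proof. by rewrite /average big_split mulrDr. Qed.

Lemma averageZ (k : cplx R) u N : average (fun n => k * u n) N = k * average u N.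
Proof. by rewrite /average -mulr_sumr mulrCA. Qed.

Lemma vanishesD u v : vanishes u -> vanishes v -> vanishes (fun n => u n + v n).
Proof.
move=> /vanishesP Hu /vanishesP Hv; apply/vanishesP => e e0.
have [|N HN] := Hu (e / 2); first lra; have [|M HM] := Hv (e / 2); first lra.
exists (maxn N M) => n; rewrite geq_max => /andP[Nn Mn]; rewrite averageD.
by apply: le_trans (normcD _ _) _; have := HN n Nn; have := HM n Mn; lra.
Qed.

Lemma vanishesZ (k : cplx R) u : vanishes u -> vanishes (fun n => k * u n).
Proof.
move=> /vanishesP Hu; apply/vanishesP => e e0; have k0 := normc_ge0 k.
have [|N HN] := Hu (e / (normc k + 1)); first by apply: divr_gt0; lra.
exists N => n Nn; rewrite averageZ normcM.
have := HN n Nn; rewrite ler_pdivlMr; last lra.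
by have := normc_ge0 (average u n); nra.
Qed.

Lemma average_bound c : (fun N : nat => \sum_(1 <= n < N.+1) `|c n| : cplx R)
      =O_\oo (fun N : nat => N%:R : cplx R) ->
  exists2 K : R, 0 < K & exists N0, forall N, (N0 <= N)%N ->
    N%:R^-1 * \sum_(n < N) normc (c n) <= K.
Proof.
move=> /eqO_exP [k k0 [N0 _ HN]].
move: k0; rewrite ltcE /= => /andP[/eqP k1 k2].
have c0 := normc_ge0 (c 0%N).
exists (normc (c 0%N) + complex.Re k); first lra.
exists N0.+1 => N NN.
have N1 : (1 <= N)%N by exact: leq_ltn_trans NN.
have N1' : 1 <= N%:R :> R by rewrite ler1n.
have := HN N (ltnW NN); rewrite /= !normcE normc_natr {HN}.
have E : \sum_(1 <= n < N.+1) `|c n| = (\sum_(1 <= n < N.+1) normc (c n))%:C%C :> R[i].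
  by rewrite rmorph_sum; apply: eq_bigr => n _; rewrite normcE.
rewrite E normc_real ger0_norm; last by apply: sumr_ge0 => n _; exact: normc_ge0.
case: k k1 k2 => kr ki /= -> k2; rewrite complexr0 -rmorphM lecR => H.
rewrite mulrC ler_pdivrMr; last lra.
apply: (@le_trans _ _ (normc (c 0%N) + \sum_(1 <= n < N.+1) normc (c n))); last first.
  have : normc (c 0%N) <= normc (c 0%N) * N%:R by rewrite ler_peMr.
  by rewrite mulrDl; lra.
rewrite -(big_mkord predT (fun n => normc (c n))) big_ltn // lerD2l.
rewrite big_nat_recr //= lerDl; exact: normc_ge0.
Qed.

(** The error made by replacing [a] with [u] is at most the supremum of
    [|a - u|] times the mean of [|c_n|]. *)
Lemma vanishes_approx c a :
  (exists2 K : R, 0 < K & exists N0, forall N, (N0 <= N)%N ->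
    N%:R^-1 * \sum_(n < N) normc (c n) <= K) ->
  (forall e : R, 0 < e -> exists2 u, vanishes (fun n => c n * u n) &
      forall n, normc (a n - u n) <= e) ->
  vanishes (fun n => c n * a n).
Proof.
move=> [K K0 [N0 HK]] H; apply/vanishesP => e e0.
have [|u /vanishesP Hu au] := H (e / (2 * K)); first by rewrite divr_gt0 // mulr_gt0.
have [|N1 HN1] := Hu (e / 2); first lra.
exists (maxn N0 N1) => N; rewrite geq_max => /andP[NN0 NN1].
have -> : average (fun n => c n * a n) N =
    average (fun n => c n * (a n - u n)) N + average (fun n => c n * u n) N.
  by rewrite -averageD; congr average; apply/funext => n; ring.
apply: le_trans (normcD _ _) _.
have -> : e = e / 2 + e / 2 by field.
apply: lerD; last exact: HN1.
rewrite /average normcM normcV normc_natr.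
apply: (@le_trans _ _ (N%:R^-1 * (\sum_(n < N) normc (c n) * (e / (2 * K))))).
  rewrite ler_wpM2l ?invr_ge0 // (le_trans (normc_sum _ _)) //.
  by apply: ler_sum => n _; rewrite normcM ler_wpM2l ?normc_ge0.
rewrite -mulr_suml mulrA; apply: (@le_trans _ _ (K * (e / (2 * K)))).
  by rewrite ler_wpM2r ?HK // ltW // divr_gt0 // mulr_gt0.
by rewrite le_eqVlt; apply/orP; left; apply/eqP; field; rewrite gt_eqF.
Qed.

End CesaroAverages.

Section Disjointness.
Variables (R : realType) (X : topologicalZmodType) (Xcompact : compact [set: X]).
Variables (T : X -> X) (Xm : metrizable R X).
Hypothesis char_qe : forall chi : X -> cplx R, is_char chi -> quasi_eigenfunctions T chi.
Variables (l : nat) (q : 'I_l -> {poly rat}) (c : nat -> cplx R).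
Hypothesis qnat : forall (j : 'I_l) (n : nat), (q j).[n%:R] \is a Num.nat.
Let Delta := (\max_(j < l) (size (q j)).-1)%N.
Hypothesis cosc : oscillating (mul_order (qds_order R T) Delta) c.

Lemma expi2pi_sum (J : Type) (s : seq J) (P : J -> R) :
  \prod_(j <- s) expi2pi (P j) = expi2pi (\sum_(j <- s) P j) :> cplx R.
Proof.
elim: s => [|j s IH]; first by rewrite !big_nil expi2pi0.
by rewrite !big_cons IH expi2piD.
Qed.

(** Composing the phases with the [q j] and adding them gives one polynomial
    phase. *)
Lemma tensor_vanishes (g : 'I_l -> X -> cplx R) (x : X) :
  (forall j, quasi_eigenfunctions T (g j)) ->
  vanishes (fun n => c n * \prod_(j < l) g j (iter (Num.truncn (q j).[n%:R]) T x)).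
Proof.
move=> gq.
have /choice[d Hd] : forall j, exists d, quasi_eigen T d (g j) /\
    forall d', qds_order R T = Some d' -> d = d'.
  by move=> j; have [d ? ?] := quasi_eigenfunction_order (gq j); exists d.
have /choice[P HP] : forall j, exists P : {poly R}, (size P <= (d j).+1)%N /\
    forall m, g j (iter m T x) = expi2pi P.[m%:R].
  by move=> j; have [P ? ?] := quasi_eigen_phase x (Hd j).1; exists P.
pose Q : {poly R} := \sum_(j < l) (P j \Po map_poly ratr (q j)).
have QE n : \prod_(j < l) g j (iter (Num.truncn (q j).[n%:R]) T x) = expi2pi Q.[n%:R].
  rewrite /Q horner_sum -expi2pi_sum; apply: eq_bigr => j _.
  rewrite (HP j).2 horner_comp -(ratr_nat R n) horner_map.
  by have := qnat j n; rewrite Num.Theory.natrEtruncn => /eqP Eq; rewrite -[in RHS]Eq rmorph_nat.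
have Hosc D : oscillating_of_order D c -> (size Q <= D.+1)%N ->
    vanishes (fun n => c n * \prod_(j < l) g j (iter (Num.truncn (q j).[n%:R]) T x)).
  move=> HD /HD; congr vanishes; apply/funext => n; by rewrite QE.
move: cosc; rewrite /oscillating /mul_order; case E : (qds_order R T) => [d'|] /= cosc'.
  apply: Hosc cosc' _; rewrite /Q; apply: (big_ind (fun p : {poly R} => (size p <= (d' * Delta).+1)%N)).
  - by rewrite size_poly0.
  - by move=> p r ps rs; rewrite (leq_trans (size_polyD _ _)) // geq_max ps.
  - move=> j _; rewrite (leq_trans (leqSpred _)) // ltnS size_comp_poly size_map_poly.
    rewrite leq_mul //; last by rewrite /Delta (leq_bigmax j).
    by have [Ps _] := HP j; rewrite -((Hd j).2 _ E); case: (size (P j)) Ps.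
(* Full oscillation is stated for positive degrees, hence the successor. *)
apply: (Hosc (size Q).+1); first exact: cosc'.
by rewrite ltnW.
Qed.

Lemma ptws_compact : compact [set: {ptws 'I_l -> X}].
Proof.
have := @tychonoff 'I_l (fun=> X) (fun=> setT) (fun=> Xcompact).
by congr compact; apply/seteqP; split.
Qed.

Definition char_tensor : set ({ptws 'I_l -> X} -> cplx R) :=
  [set F | exists2 g : 'I_l -> X -> cplx R, (forall j, is_char (g j)) &
     F = fun z => \prod_(j < l) g j (z j)].

Lemma prod_cont (J : Type) (s : seq J) (F : J -> {ptws 'I_l -> X} -> cplx R) :
  (forall j, continuous (F j)) -> continuous (fun z => \prod_(j <- s) F j z).
Proof.
move=> cF; elim: s => [|j s IH].
  rewrite (_ : (fun z => _) = fun=> 1); first exact: ccont_cst.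
  by apply/funext => z; rewrite big_nil.
rewrite (_ : (fun z => _) = fun z => F j z * \prod_(i <- s) F i z).
  by apply: ccontM; [exact: cF|exact: IH].
by apply/funext => z; rewrite big_cons.
Qed.

Lemma coord_cont (g : X -> cplx R) j : continuous g ->
  continuous (fun z : {ptws 'I_l -> X} => g (z j)).
Proof.
move=> cg z; apply: (@continuous_comp {ptws 'I_l -> X} X _ (fun z => z j) g); last exact: cg.
exact: (@proj_continuous 'I_l (fun=> X) j z).
Qed.

Lemma polynomial_orbit_vanishes (F : {ptws 'I_l -> X} -> cplx R) (x : X) :
  (fun N : nat => \sum_(1 <= n < N.+1) `|c n| : cplx R)
      =O_\oo (fun N : nat => N%:R : cplx R) ->
  continuous F ->
  vanishes (fun n => c n * F (fun j => iter (Num.truncn (q j).[n%:R]) T x)).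
Proof.
move=> cO cF; apply: (vanishes_approx (average_bound cO)) => e e0.
have [G sG FG] : exists2 G, span char_tensor G & forall z, normc (F z - G z) <= e.
  apply: (span_dense ptws_compact) cF _ e0.
  - move=> G [g gc ->]; apply: prod_cont => j; apply: coord_cont.
    by have [] := gc j.
  - exists (fun _ _ => 1); first by move=> j; exact: char_one.
    by apply/funext => z; rewrite big1.
  - move=> _ _ [g gc ->] [h hc ->]; exists (fun j x => g j x * h j x).
      by move=> j; apply: charM.
    by apply/funext => z; rewrite big_split.
  - move=> _ [g gc ->]; exists (fun j x => conjc (g j x)).
      by move=> j; apply: char_conj.
    by apply/funext => z; rewrite (rmorph_prod (@conjc R)).
  - move=> z w zw; have [j zwj] : exists j, z j != w j.
      apply: contrapT => H; case/eqP: zw; apply/funext => j.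
      by apply: contrapT => zwj; apply: H; exists j; apply/eqP.
    have [chi cchi chizw] := chars_separate Xcompact Xm zwj.
    exists (fun z => chi (z j)) => //.
    exists (fun i => if i == j then chi else fun=> 1).
      by move=> i; case: eqP => _ //; exact: char_one.
    apply/funext => y; rewrite (bigD1 j) //= eqxx big1 ?mulr1 // => i /negPf ->.
    by [].
exists (fun n => G (fun j => iter (Num.truncn (q j).[n%:R]) T x)); last by move=> n; exact: FG.
elim: sG => [|k g f [h hc ->] _ IH].
  apply/vanishesP => d d0; exists 0%N => N _.
  by rewrite /average big1 ?mulr0 ?normc0 ?ltW // => n _; rewrite mulr0.
have := vanishesD (vanishesZ k (tensor_vanishes x (fun j => char_qe (hc j)))) IH.
by congr vanishes; apply/funext => n; ring.
Qed.

End Disjointness.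

Theorem corollary1 (R : realType) (X : topologicalZmodType)
    (Xconnected : connected [set: X]) (Xcompact : compact [set: X])
    (Xmetrizable : metrizable R X)
    (T : X -> X) (Taffine : affine_transformation T) (Tminimal : minimal_map T) :
  has_quasi_discrete_spectrum R T /\
  forall (l : nat) (q : 'I_l -> {poly rat}) (c : nat -> cplx R),
    let Delta := (\max_(j < l) (size (q j)).-1)%N in
    (1 <= l)%N ->
    (forall (j : 'I_l) (n : nat), (q j).[n%:R] \is a Num.nat) ->
    (1 <= Delta)%N ->
    oscillating (mul_order (qds_order R T) Delta) c ->
    (fun N : nat => \sum_(1 <= n < N.+1) `|c n| : cplx R)
      =O_\oo (fun N : nat => N%:R : cplx R) ->
    forall (F : {ptws 'I_l -> X} -> cplx R), continuous F ->
    forall x : X,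
      average (fun n => c n * F (fun j => iter (Num.truncn (q j).[n%:R]) T x)) N
        @[N --> \oo] --> (0 : cplx R).
Proof.
have [A [b [_ Acont TE]]] := Taffine.
have char_qe (chi : X -> cplx R) : is_char chi -> quasi_eigenfunctions T chi.
  exact: (char_quasi_eigenfunction Xcompact Xconnected Acont TE Tminimal).
split; first exact: (quasi_discrete_spectrum Xcompact Xconnected Acont TE Tminimal Xmetrizable).
move=> l q c Delta _ qnat _ cosc cO F cF x.
exact: (polynomial_orbit_vanishes Xcompact Xmetrizable char_qe qnat cosc x cO cF).
Qed.
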